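(* For every prime power $q$, every maximum Erdős–Ko–Rado set of chambers of $\mathbb{F}_q^{4}$ is of classical type. Equivalently: if $\mathcal{F}$ is a maximum EKR-set of chambers of $\mathbb{F}_q^4$, then for any two chambers $C,D\in\mathcal{F}$ the $2$-dimensional subspaces $C_2$ and $D_2$ intersect non-trivially.
   Context: A chamber of $\mathbb{F}_q^{4}$ is a set $C=\{C_1,C_2,C_3\}$ of subspaces with $C_1\subset C_2\subset C_3$ and $\dim C_i=i$. Two chambers $C,D$ are opposite if $C_i\cap D_{4-i}=\{0\}$ for $i=1,2,3$. An EKR-set of chambers is a set of chambers no two of which are opposite; it is maximum if it has the largest possible size among all EKR-sets. An EKR-set is of classical type if either there is a $1$-dimensional subspace $P$ such that it is the set of all chambers $C$ with $P\le C_2$, or there is a $3$-dimensional subspace $H$ such that it is the set of all chambers $C$ with $C_2\le H$. *)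

(* Defs.v *)
From HB Require Import structures.
From mathcomp Require Import all_boot all_order all_algebra.

Set Implicit Arguments.
Unset Strict Implicit.
Unset Printing Implicit Defensive.

Import GRing.Theory.

Local Open Scope ring_scope.

(* {vspace vT} is a subtype of square matrices, hence finite when the field   *)
(* of scalars is; the library only declares its choiceType structure.         *)
HB.instance Definition _ (F : finFieldType) (vT : vectType F) :=
  Countable.copy {vspace vT} (can_type (@VectorInternalTheory.vs2mxK F vT)).
HB.instance Definition _ (F : finFieldType) (vT : vectType F) :
  isFinite {vspace vT} := CanIsFinite (@VectorInternalTheory.vs2mxK F vT).

Section Chambers.

Variable F : finFieldType.

Notation subspace := {vspace 'rV[F]_4}.

Definition is_chamber (c : subspace * subspace * subspace) : bool :=
  let: (U1, U2, U3) := c in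
  [&& (U1 <= U2)%VS, (U2 <= U3)%VS,
      \dim U1 == 1%N, \dim U2 == 2%N & \dim U3 == 3%N].

(* As its members have distinct dimensions, the set {C_1, C_2, C_3} is        *)
(* encoded by the triple (C_1, C_2, C_3).                                     *)
Record chamber := Chamber {
  chamber_val : subspace * subspace * subspace;
  chamberP : is_chamber chamber_val }.

HB.instance Definition _ := [isSub for chamber_val].
HB.instance Definition _ := [Finite of chamber by <:].

Definition chamber1 (C : chamber) : subspace := (chamber_val C).1.1.
Definition chamber2 (C : chamber) : subspace := (chamber_val C).1.2.
Definition chamber3 (C : chamber) : subspace := (chamber_val C).2.

Definition opposite (C D : chamber) : bool :=
  [&& (chamber1 C :&: chamber3 D)%VS == 0%VS,
      (chamber2 C :&: chamber2 D)%VS == 0%VS &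
      (chamber3 C :&: chamber1 D)%VS == 0%VS].

Definition EKR_set (A : {set chamber}) : Prop :=
  forall C D, C \in A -> D \in A -> ~~ opposite C D.

Definition maximum_EKR_set (A : {set chamber}) : Prop :=
  EKR_set A /\ forall B : {set chamber}, EKR_set B -> (#|B| <= #|A|)%N.

Definition classical_type (A : {set chamber}) : Prop :=
  (exists P : subspace, \dim P = 1%N /\
     A = [set C : chamber | (P <= chamber2 C)%VS])
  \/
  (exists H : subspace, \dim H = 3%N /\
     A = [set C : chamber | (chamber2 C <= H)%VS]).

End Chambers.

(* Main.v *)
Require Import Defs.
From mathcomp Require Import all_boot all_order all_algebra all_field.
From mathcomp Require Import ring lra zify.

(* Let c be the 0/1 indicator of an EKR-set A and m = q + 1. Two chambers can   *)
(* be opposite only if their lines l, l' are skew; then the points of l         *)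
(* correspond to the planes through l' and vice versa, and oppositeness becomes *)
(* the relation "x <> x' and y <> y'" on an m x m grid. Decomposing c on each   *)
(* line into a line mean x/m^2, a point deviation u/m, a plane deviation w/m    *)
(* and an interaction z, the absence of opposite pairs reads                    *)
(*   (q/m)^2 sum x x' - 2 (q/m) M(u, w) + sum z z' = 0                          *)
(* (sums over pairs of skew lines). Each of the three terms is bounded from     *)
(* below by an explicit sum of squares, and together these bounds give          *)
(* |A| <= (q+1)^2 (q^2+q+1), the size of the sets of classical type. In the     *)
(* case of equality all squares vanish, which forces                            *)
(*   c(P, l, s) = b(l) + h(P) + k(s)   with   q k(s) = sum_(P in s) h(P).       *)
(* As c is 0/1-valued, h is constant on l or k is constant on the planes        *)
(* through l, for every line l; a counting argument then shows that h and k are *)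
(* constant. So A consists of all chambers on a set of lines, which must meet   *)
(* pairwise, hence share a point or lie in a plane.                             *)

Set Implicit Arguments.
Unset Strict Implicit.
Unset Printing Implicit Defensive.

Import Order.TTheory GRing.Theory Num.Theory.

Local Open Scope ring_scope.

(** * Finite sums *)

(** The proof is a spectral bound made explicit by sums of squares, with an analysis of the equality
    case. For an EKR-set the number of opposite pairs over all pairs of skew lines is zero, and
    [skew_total] splits this number into the contributions of line weights, deviations and
    residuals. They are bounded by [sum_skew_line_wt] (the skewness graph on lines), by
    [skew_form_sos] (the form coupling point and plane deviations) and by the squares expanded in
    [sum_zsq]. If the set is at least as large as a set of classical type, the total zero is a sum
    of nonnegative terms, so each term vanishes; this is [extremal].

    The residual then takes opposite values at matched chambers on skew lines. By [residual_pencil]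
    it depends only on the point and the plane, and its zero line sums inside a fixed plane kill it
    ([residual0]). The indicator is left as a sum of a line, a point and a plane function, and
    [two_valued_const] shows the latter two constant because only the values 0 and 1 occur. Hence
    the set contains all chambers on a line or none ([chi_fibre]), its lines meet pairwise, and
    [pairwise_meeting] gives a common point or plane. Maximality turns the resulting inclusion into
    an equality in [maximum_EKR_classical].

    All of this is carried out in an abstract projective 3-space [space3]; [PG3] is the model formed
    by the subspaces of the vector space. *)

Lemma sum_delta (T : finType) (f : T -> rat) (x : T) :
  \sum_y f y * (x == y)%:R = f x.
Proof.
rewrite (bigD1 x) //= eqxx mulr1 big1 ?addr0 // => y.
by rewrite eq_sym => /negPf ->; rewrite mulr0.
Qed.

Lemma sum_boolE (T : finType) (b : pred T) : \sum_x (b x)%:R = #|b|%:R :> rat.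
Proof.
rewrite -sum1_card natr_sum [RHS]big_mkcond /=; apply: eq_bigr => x _.
by rewrite unfold_in; case: (b x).
Qed.

Section DoubleSums.

Variables A B : finType.
Implicit Types (F H : A -> B -> rat) (f : A -> rat) (g : B -> rat).

Definition dsum F : rat := \sum_a \sum_b F a b.

Lemma eq_dsum F H : (forall a b, F a b = H a b) -> dsum F = dsum H.
Proof. by move=> eqFH; apply: eq_bigr => a _; apply: eq_bigr. Qed.

Lemma dsumD F H : dsum (fun a b => F a b + H a b) = dsum F + dsum H.
Proof. by rewrite -big_split; apply: eq_bigr => a _; rewrite big_split. Qed.

Lemma dsumZ c F : dsum (fun a b => c * F a b) = c * dsum F.
Proof. by rewrite mulr_sumr; apply: eq_bigr => a _; rewrite mulr_sumr. Qed.

Lemma dsumMl f F : dsum (fun a b => f a * F a b) = \sum_a f a * \sum_b F a b.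
Proof. by apply: eq_bigr => a _; rewrite mulr_sumr. Qed.

Lemma dsumMr g F : dsum (fun a b => g b * F a b) = \sum_b g b * \sum_a F a b.
Proof.
by rewrite /dsum exchange_big; apply: eq_bigr => b _; rewrite mulr_sumr.
Qed.

Lemma dsum_ge0 F : (forall a b, 0 <= F a b) -> 0 <= dsum F.
Proof. by move=> F_ge0; apply: sumr_ge0 => a _; apply: sumr_ge0. Qed.

Lemma dsum_eq0 F : (forall a b, 0 <= F a b) -> dsum F = 0 -> forall a b, F a b = 0.
Proof.
move=> F_ge0 /eqP; rewrite psumr_eq0 => [/allP h a b|a _]; last exact: sumr_ge0.
have := h a (mem_index_enum a); rewrite /= psumr_eq0 => [/allP h'|//].
by apply/eqP; exact: h' (mem_index_enum b).
Qed.

Lemma dsum_sqr_ge0 F : 0 <= dsum (fun a b => F a b ^+ 2).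
Proof. by apply: dsum_ge0 => a b; exact: sqr_ge0. Qed.

Lemma dsum_sqr_eq0 F : dsum (fun a b => F a b ^+ 2) = 0 -> forall a b, F a b = 0.
Proof.
move=> F0 a b; apply/eqP; rewrite -sqrf_eq0; apply/eqP.
by apply: (dsum_eq0 _ F0) => *; exact: sqr_ge0.
Qed.

End DoubleSums.

Lemma dsumC (A B : finType) (F : A -> B -> rat) :
  dsum F = dsum (fun b a => F a b).
Proof. exact: exchange_big. Qed.

(** A quadratic form whose matrix is [c] times the all-one matrix plus [d] times the identity. Every
    product of an incidence matrix with its transpose has this shape, up to the skewness term for
    pairs of lines. *)
Lemma sum_sqr_eq (T : finType) (f : T -> rat) (c d : rat) (K : T -> T -> rat) :
  (forall x y, K x y = c + d * (x == y)%:R) ->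
  dsum (fun x y => f x * f y * K x y) = c * (\sum_x f x) ^+ 2 + d * \sum_x f x ^+ 2.
Proof.
move=> hK; rewrite (eq_dsum (H := fun x y => c * (f x * f y) + d * (f x * (f y * (x == y)%:R)))).
  rewrite dsumD !dsumZ !dsumMl; congr (_ * _ + _ * _).
    by rewrite -mulr_suml.
  by apply: eq_bigr => x _; rewrite sum_delta expr2.
by move=> x y; rewrite hK; ring.
Qed.

Lemma dsum0 (A B : finType) (F : A -> B -> rat) :
  (forall a b, F a b = 0) -> dsum F = 0.
Proof. by move=> F0; rewrite /dsum big1 // => a _; rewrite big1. Qed.

Lemma dsum_prod (A B : finType) (f : A -> rat) (g : B -> rat) :
  dsum (fun a b => f a * g b) = (\sum_a f a) * \sum_b g b.
Proof. by rewrite dsumMl mulr_suml. Qed.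

Lemma dsum_exchange (A B A' B' : finType) (F : A -> B -> A' -> B' -> rat) :
  dsum (fun a b => dsum (fun a' b' => F a b a' b')) =
  dsum (fun a' b' => dsum (fun a b => F a b a' b')).
Proof.
rewrite /dsum; under eq_bigr => a _ do rewrite exchange_big /=.
rewrite exchange_big /=; apply: eq_bigr => a' _.
under eq_bigr => a _ do rewrite exchange_big /=.
by rewrite exchange_big.
Qed.

(** * Projective 3-spaces *)

(* The axioms are invariant under exchanging points and planes, so that every  *)
(* lemma about G can be applied to [dual G].                                    *)
Record space3 := Space3 {
  point : finType;
  line : finType;
  plane : finType;
  order : nat;
  on_pl : point -> line -> bool;
  on_lp : line -> plane -> bool;
  on_pp : point -> plane -> bool;
  skew : rel line;
  some_point : point;
  some_plane : plane;
  order_gt1 : (1 < order)%N;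
  points_of_line l : \sum_P (on_pl P l)%:R = order%:R + 1 :> rat;
  planes_of_line l : \sum_s (on_lp l s)%:R = order%:R + 1 :> rat;
  lines_of_point P : \sum_l (on_pl P l)%:R = order%:R ^+ 2 + order%:R + 1 :> rat;
  lines_of_plane s : \sum_l (on_lp l s)%:R = order%:R ^+ 2 + order%:R + 1 :> rat;
  join_points P P' : P != P' -> \sum_l (on_pl P l)%:R * (on_pl P' l)%:R = 1 :> rat;
  meet_planes s s' : s != s' -> \sum_l (on_lp l s)%:R * (on_lp l s')%:R = 1 :> rat;
  pencil P s : \sum_l (on_pl P l)%:R * (on_lp l s)%:R =
    (order%:R + 1) * (on_pp P s)%:R :> rat;
  points_line_plane l s : \sum_P (on_pl P l)%:R * (on_pp P s)%:R =
    1 + order%:R * (on_lp l s)%:R :> rat;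
  planes_line_point l P : \sum_s (on_lp l s)%:R * (on_pp P s)%:R =
    1 + order%:R * (on_pl P l)%:R :> rat;
  common_points l l' : \sum_P (on_pl P l)%:R * (on_pl P l')%:R =
    1 - (skew l l')%:R + order%:R * (l == l')%:R :> rat;
  common_planes l l' : \sum_s (on_lp l s)%:R * (on_lp l' s)%:R =
    1 - (skew l l')%:R + order%:R * (l == l')%:R :> rat }.

Arguments skew {_}.
Arguments on_pl {_}.
Arguments on_lp {_}.
Arguments on_pp {_}.

Lemma pencil_dual_swap (G : space3) (s : plane G) (P : point G) :
  \sum_l (on_lp l s)%:R * (on_pl P l)%:R =
    ((order G)%:R + 1) * (on_pp P s)%:R :> rat.
Proof. by rewrite -pencil; apply: eq_bigr => l _; rewrite mulrC. Qed.

Definition dual (G : space3) : space3 :=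
  @Space3 (plane G) (line G) (point G) (order G)
    (fun s l => on_lp l s) (fun l P => on_pl P l) (fun s P => on_pp P s) skew
    (some_plane G) (some_point G) (order_gt1 G)
    (@planes_of_line G) (@points_of_line G) (@lines_of_plane G) (@lines_of_point G)
    (@meet_planes G) (@join_points G) (@pencil_dual_swap G)
    (@planes_line_point G) (@points_line_plane G)
    (@common_planes G) (@common_points G).

(** * Counting identities and incidence facts *)

Section Incidence.

Variable G : space3.

Definition gq : rat := (order G)%:R.
Definition ipl (P : point G) (l : line G) : rat := (on_pl P l)%:R.
Definition ilp (l : line G) (s : plane G) : rat := (on_lp l s)%:R.
Definition ipp (P : point G) (s : plane G) : rat := (on_pp P s)%:R.
Definition isk (l l' : line G) : rat := (skew l l')%:R.

Local Notation q := gq.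
Local Notation i := ipl.
Local Notation j := ilp.
Local Notation e := ipp.
Local Notation D := isk.

Lemma gq_ge2 : 2 <= q.
Proof. by rewrite /q (ler_nat _ 2) order_gt1. Qed.

Lemma ipl_idem P l : i P l * i P l = i P l.
Proof. by rewrite /i; case: on_pl; rewrite ?mulr1 ?mulr0. Qed.
Lemma ilp_idem l s : j l s * j l s = j l s.
Proof. by rewrite /j; case: on_lp; rewrite ?mulr1 ?mulr0. Qed.
Lemma ipp_idem P s : e P s * e P s = e P s.
Proof. by rewrite /e; case: on_pp; rewrite ?mulr1 ?mulr0. Qed.

Lemma sum_ipl_l l : \sum_P i P l = q + 1.
Proof. exact: points_of_line. Qed.
Lemma sum_ilp_r l : \sum_s j l s = q + 1.
Proof. exact: planes_of_line. Qed.
Lemma sum_ipl_r P : \sum_l i P l = q ^+ 2 + q + 1.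
Proof. exact: lines_of_point. Qed.
Lemma sum_ipl_ilp P s : \sum_l i P l * j l s = (q + 1) * e P s.
Proof. exact: pencil. Qed.
Lemma sum_ipl_ipp l s : \sum_P i P l * e P s = 1 + q * j l s.
Proof. exact: points_line_plane. Qed.
Lemma sum_ilp_ipp l P : \sum_s j l s * e P s = 1 + q * i P l.
Proof. exact: planes_line_point. Qed.
Lemma sum_ipl_common l l' : \sum_P i P l * i P l' = 1 - D l l' + q * (l == l')%:R.
Proof. exact: common_points. Qed.

Lemma sum_ipl_join P P' :
  \sum_l i P l * i P' l = 1 + (q ^+ 2 + q) * (P == P')%:R.
Proof.
case: eqP => [<-|/eqP neqP]; last by rewrite mulr0 addr0 join_points.
rewrite (eq_bigr (i P)) => [|l _]; last exact: ipl_idem.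
by rewrite sum_ipl_r /=; ring.
Qed.

Lemma sum_ipp_r P : \sum_s e P s = q ^+ 2 + q + 1.
Proof.
have q2 := gq_ge2.
have /mulfI : q + 1 != 0 by lra.
apply; rewrite mulr_sumr.
under eq_bigr => s _ do rewrite -sum_ipl_ilp.
rewrite exchange_big /=.
under eq_bigr => l _ do rewrite -mulr_sumr sum_ilp_r.
by rewrite -mulr_suml sum_ipl_r mulrC.
Qed.

(** After multiplication by [q + 1], the incidence of [P] with [s] is counted by the lines of the
    pencil that they determine, which reduces the planes on two points to the lines on two
    points. *)
Lemma sum_ipp_ipp P P' :
  \sum_s e P s * e P' s = q + 1 + q ^+ 2 * (P == P')%:R.
Proof.
have q2 := gq_ge2.
have /mulfI : q + 1 != 0 by lra.
apply; rewrite mulr_sumr.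
under eq_bigr => s _ do rewrite mulrA -sum_ipl_ilp mulr_suml.
rewrite exchange_big /=.
under eq_bigr => l _.
  under eq_bigr => s _ do rewrite -mulrA.
  rewrite -mulr_sumr sum_ilp_ipp mulrDr mulr1 mulrCA.
  over.
by rewrite big_split /= sum_ipl_r -mulr_sumr sum_ipl_join; ring.
Qed.

(** On functions of sum zero the point-plane incidence matrix is, up to the factor [q], an isometry;
    this inversion formula is what later recovers [h] from its plane sums. *)
Lemma sum_ipp_fun (f : point G -> rat) P :
  \sum_s e P s * \sum_X e X s * f X = (q + 1) * (\sum_X f X) + q ^+ 2 * f P.
Proof.
under eq_bigr => s _ do rewrite mulr_sumr.
rewrite exchange_big /=.
transitivity (\sum_X ((q + 1) * f X + q ^+ 2 * (f X * (P == X)%:R))).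
  apply: eq_bigr => X _; transitivity (f X * \sum_s e P s * e X s).
    by rewrite mulr_sumr; apply: eq_bigr => s _; ring.
  by rewrite sum_ipp_ipp; ring.
by rewrite big_split /= -!mulr_sumr sum_delta.
Qed.

Lemma card_point : \sum_(P : point G) 1 = (q ^+ 2 + 1) * (q + 1) :> rat.
Proof.
have : \sum_l i (some_point G) l * \sum_P i P l = (q ^+ 2 + q + 1) * (q + 1).
  under eq_bigr => l _ do rewrite sum_ipl_l.
  by rewrite -mulr_suml sum_ipl_r.
under eq_bigr => l _ do rewrite mulr_sumr.
rewrite exchange_big /=.
under eq_bigr => P _ do rewrite sum_ipl_join.
rewrite big_split /= sum_delta => h.
by apply: (addIr (q ^+ 2 + q)); rewrite h; ring.
Qed.

Lemma card_line : \sum_(l : line G) 1 = (q ^+ 2 + 1) * (q ^+ 2 + q + 1) :> rat.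
Proof.
have q2 := gq_ge2.
have /mulfI : q + 1 != 0 by lra.
apply; rewrite mulr_sumr.
under eq_bigr => l _ do rewrite mulr1 -(sum_ipl_l l).
rewrite exchange_big /=.
under eq_bigr => P _ do rewrite sum_ipl_r -[_ + 1]mul1r.
by rewrite -mulr_suml card_point; ring.
Qed.

Lemma sum_isk l : \sum_l' D l l' = q ^+ 4.
Proof.
have : \sum_P i P l * \sum_l' i P l' = (q ^+ 2 + q + 1) * (q + 1).
  under eq_bigr => P _ do rewrite sum_ipl_r.
  by rewrite -mulr_suml sum_ipl_l mulrC.
under eq_bigr => P _ do rewrite mulr_sumr.
rewrite exchange_big /=.
under eq_bigr => l' _ do rewrite sum_ipl_common.
rewrite !big_split /= sum_delta sumrN card_line => h.
by apply: oppr_inj; apply: (addrI ((q ^+ 2 + 1) * (q ^+ 2 + q + 1)));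
  apply: (addIr q); rewrite h; ring.
Qed.

Lemma isk_sym (l l' : line G) : isk l l' = isk l' l.
Proof.
have := sum_ipl_common l' l; have := sum_ipl_common l l'.
under eq_bigr do rewrite mulrC.
by rewrite [l' == l]eq_sym => -> h; lra.
Qed.

Lemma on_pl_lp (P : point G) l (s : plane G) : on_pl P l -> on_lp l s -> on_pp P s.
Proof.
move=> Pl ls; apply: contraT => /negPf ePs.
have := sum_ipl_ilp P s; rewrite /e ePs mulr0 => /eqP.
rewrite psumr_eq0 => [/allP/(_ l)|l' _]; last by rewrite /i /j -natrM ler0n.
by rewrite mem_index_enum /i /j Pl ls mulr1 oner_eq0 => /(_ isT).
Qed.

Lemma join_on_plane (P P' : point G) l (s : plane G) : P != P' -> on_pl P l -> on_pl P' l ->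
  on_pp P s -> on_pp P' s -> on_lp l s.
Proof.
move=> neqP Pl P'l Ps P's; apply: contraT => /negPf ls.
have := sum_ipl_ipp l s.
rewrite /j ls mulr0 addr0 (bigD1 P) //= (bigD1 P') 1?eq_sym //=.
rewrite /i /e Pl P'l Ps P's /=.
have : 0 <= \sum_(P0 | (P0 != P) && (P0 != P')) i P0 l * e P0 s.
  by apply: sumr_ge0 => P0 _; rewrite /i /e -natrM ler0n.
by rewrite /i /e; lra.
Qed.

Lemma pl_not_skew (P : point G) l l' : on_pl P l -> on_pl P l' -> skew l l' = false.
Proof.
move=> Pl Pl'; apply/negP => sk.
have := sum_ipl_common l l'; rewrite /D sk /= (bigD1 P) //= /i Pl Pl' /=.
have : 0 <= \sum_(P0 | P0 != P) i P0 l * i P0 l'.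
  by apply: sumr_ge0 => P0 _; rewrite /i -natrM ler0n.
case: eqP => [ll'|_]; last by rewrite /i /=; lra.
suff -> : \sum_(P0 | P0 != P) (on_pl P0 l)%:R * (on_pl P0 l')%:R = q :> rat.
  by rewrite /=; lra.
have := sum_ipl_l l; rewrite (bigD1 P) //= {1}/i Pl -ll' => h.
rewrite (eq_bigr (fun P => i P l)) => [|P0 _]; last exact: ipl_idem.
by move: h; rewrite /i /=; lra.
Qed.

Lemma skew_pl (l l' : line G) : ~~ skew l l' -> exists2 P, on_pl P l & on_pl P l'.
Proof.
move=> /negPf nsk; apply/exists_inP; rewrite -[X in is_true X]negbK.
apply/negP; rewrite negb_exists => /forallP noP.
have := sum_ipl_common l l'; rewrite /D nsk big1 => [|P _]; last first.
  by move: (noP P); rewrite /i; do 2 case: on_pl => //=; rewrite ?mulr0 ?mul0r.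
have := gq_ge2; have : 0 <= (l == l')%:R :> rat by rewrite ler0n.
by rewrite subr0 /=; nra.
Qed.

Lemma exists_join (P P' : point G) : exists2 l, on_pl P l & on_pl P' l.
Proof.
apply/exists_inP; rewrite -[X in is_true X]negbK.
apply/negP; rewrite negb_exists => /forallP nol.
have := sum_ipl_join P P'; rewrite big1 => [|l _]; last first.
  by move: (nol l); rewrite /i; do 2 case: on_pl => //=; rewrite ?mulr0 ?mul0r.
have := gq_ge2; have : 0 <= (P == P')%:R :> rat by rewrite ler0n.
by rewrite /=; nra.
Qed.

Lemma exists_pl (l : line G) : exists P, on_pl P l.
Proof.
apply/existsP; rewrite -[X in is_true X]negbK.
apply/negP; rewrite negb_exists => /forallP noP.
have := sum_ipl_l l; rewrite big1 => [|P _]; last first.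
  by move: (noP P); rewrite /i; case: on_pl.
by have := gq_ge2; lra.
Qed.

Lemma exists_pl_pp (l : line G) (s : plane G) : exists2 P, on_pl P l & on_pp P s.
Proof.
apply/exists_inP; rewrite -[X in is_true X]negbK.
apply/negP; rewrite negb_exists => /forallP noP.
have := sum_ipl_ipp l s; rewrite big1 => [|P _]; last first.
  by move: (noP P); rewrite /i /e; case: on_pl; case: on_pp => //=; rewrite ?mulr0 ?mul0r.
have := gq_ge2; have : 0 <= j l s by rewrite ler0n.
by rewrite /=; nra.
Qed.

Lemma skew_sym (l l' : line G) : skew l l' = skew l' l.
Proof.
by have := isk_sym l l'; rewrite /isk; do 2 case: skew.
Qed.

End Incidence.

Lemma lp_not_skew (G : space3) (s : plane G) (l l' : line G) :
  on_lp l s -> on_lp l' s -> skew l l' = false.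
Proof. exact: (@pl_not_skew (dual G)). Qed.

Lemma exists_lp (G : space3) (l : line G) : exists s, on_lp l s.
Proof. exact: (@exists_pl (dual G)). Qed.

Lemma exists_lp_pp (G : space3) (l : line G) (P : point G) :
  exists2 s, on_lp l s & on_pp P s.
Proof. exact: (@exists_pl_pp (dual G)). Qed.

Lemma exists_meet (G : space3) (s s' : plane G) : exists2 l, on_lp l s & on_lp l s'.
Proof. exact: (@exists_join (dual G)). Qed.

(** When [l'] is not in [s], it meets [s] only in [P], so it can meet [l] only there. This turns
    skewness into two independent conditions on [P], [l] and on [l'], [s]. *)
Lemma skew_coplanar (G : space3) (P : point G) (l l' : line G) (s : plane G) :
  on_lp l s -> on_pl P l' -> on_pp P s ->
  skew l l' = ~~ on_pl P l && ~~ on_lp l' s.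
Proof.
move=> ls Pl' Ps; case: (boolP (on_pl P l)) => [Pl|nPl] /=.
  exact: pl_not_skew Pl Pl'.
case: (boolP (on_lp l' s)) => [l's|nl's] /=; first exact: lp_not_skew ls l's.
apply: contraT => /skew_pl[X Xl Xl']; case/negP: nl's.
apply: (@join_on_plane _ X P) => //; last exact: on_pl_lp Xl ls.
by apply: contraNneq nPl => <-.
Qed.

(** * The skewness form on flag functions *)

Section FlagFunction.

Variables (G : space3) (u : point G -> line G -> rat).
Hypothesis u_flag : forall P l, ipl P l * u P l = u P l.
Hypothesis u_line : forall l, \sum_P u P l = 0.

Local Notation q := (gq G).
Local Notation i := ipl.
Local Notation j := ilp.
Local Notation e := ipp.

Definition pt_sum (P : point G) := \sum_l u P l.
(** If [u P l] is [h P] minus the mean of [h] on [l] at every flag, with [h] of sum zero, then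
    summing over the lines through [P] gives [(q ^+ 2 + 1) * h P]; dividing by this factor recovers
    [h]. *)
Definition pt_avg (P : point G) := pt_sum P / (q ^+ 2 + 1).
Definition pp_sum (P : point G) (s : plane G) := \sum_l u P l * j l s.
Definition plane_sum (s : plane G) := \sum_P e P s * pt_avg P.
Definition line_sum (l : line G) := \sum_P i P l * pt_avg P.
(* The component of u orthogonal to the flag functions of the form              *)
(* h P - (average of h on l).                                                   *)
Definition pure_part (P : point G) (l : line G) :=
  u P l - i P l * (pt_avg P - line_sum l / (q + 1)).
(** This is [pp_sum] of [pure_part]: the subtracted term is the sum of [h P] minus the line mean
    over the [q + 1] lines of the pencil of [P] and [s]. *)
Definition pp_pure (P : point G) (s : plane G) :=
  pp_sum P s - e P s * ((q ^+ 2 + q + 1) / (q + 1) * pt_avg P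
                        - (q + 1)^-1 * plane_sum s).

Local Notation U := pt_sum.
Local Notation h := pt_avg.
Local Notation uj := pp_sum.
Local Notation hs := plane_sum.
Local Notation hl := line_sum.
Local Notation nu := (dsum (fun P l => u P l ^+ 2)).
Local Notation nh := (\sum_P h P ^+ 2).

Lemma pt_sumE P : U P = (q ^+ 2 + 1) * h P.
Proof.
have q2 := gq_ge2 G; rewrite /h mulrC divfK //.
by apply: lt0r_neq0; nra.
Qed.

Lemma sum_pt_sum : \sum_P U P = 0.
Proof. by rewrite exchange_big big1. Qed.

Lemma sum_pt_avg : \sum_P h P = 0.
Proof. by rewrite -mulr_suml sum_pt_sum mul0r. Qed.

Lemma pp_sum_flag P s : e P s * uj P s = uj P s.
Proof.
rewrite mulr_sumr; apply: eq_bigr => l _.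
rewrite -u_flag /i /j /e; case: (boolP (on_pl P l)) => [Pl|_]; last first.
  by rewrite !mul0r mulr0.
case: (boolP (on_lp l s)) => [ls|_]; last by rewrite !mulr0.
by rewrite (on_pl_lp Pl ls) !mul1r.
Qed.

Lemma sum_pp_sum_point s : \sum_P uj P s = 0.
Proof.
by rewrite exchange_big big1 // => l _; rewrite -mulr_suml u_line mul0r.
Qed.

Lemma sum_pp_sum_plane P : \sum_s uj P s = (q + 1) * U P.
Proof.
rewrite exchange_big mulr_sumr; apply: eq_bigr => l _.
by rewrite -mulr_sumr sum_ilp_r mulrC.
Qed.

(** Two distinct lines through [P] span exactly one plane, and one line lies in [q + 1] planes, so
    for fixed [P] the matrix of the form is [1 + q * (l == l')]. *)
Lemma norm_pp_sum :
  dsum (fun P s => uj P s ^+ 2) = q * nu + (q ^+ 2 + 1) ^+ 2 * nh.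
Proof.
have -> : (q ^+ 2 + 1) ^+ 2 * nh = \sum_P U P ^+ 2.
  by rewrite mulr_sumr; apply: eq_bigr => P _; rewrite -exprMn -pt_sumE.
rewrite /dsum mulr_sumr -big_split /=; apply: eq_bigr => P _.
transitivity (dsum (fun l l' => u P l * u P l' * (1 + q * (l == l')%:R))).
  under eq_bigr => s _ do rewrite expr2 {1}/uj mulr_suml.
  rewrite exchange_big /=; apply: eq_bigr => l _.
  under eq_bigr => s _ do rewrite mulr_sumr.
  rewrite exchange_big /=; apply: eq_bigr => l' _.
  rewrite (eq_bigr (fun s => u P l * u P l' * (j l s * j l' s))); last first.
    by move=> s _; ring.
  rewrite -mulr_sumr [\sum_s _]common_planes.
  rewrite -(u_flag P l) -(u_flag P l') /i.
  case: (boolP (on_pl P l)) => Pl; last by rewrite !mul0r.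
  case: (boolP (on_pl P l')) => Pl'; last by rewrite !(mul0r, mulr0).
  by rewrite (pl_not_skew Pl Pl') subr0.
by rewrite (@sum_sqr_eq _ (u P) 1 q) // mul1r addrC.
Qed.

Lemma sum_ipp_plane_sum P : \sum_s e P s * hs s = q ^+ 2 * h P.
Proof. by rewrite sum_ipp_fun sum_pt_avg mulr0 add0r. Qed.

Lemma norm_plane_sum : \sum_s hs s ^+ 2 = q ^+ 2 * nh.
Proof.
transitivity (dsum (fun P s => h P * (e P s * hs s))).
  rewrite dsumC; apply: eq_bigr => s _; rewrite expr2 {1}/hs mulr_suml.
  by apply: eq_bigr => P _; ring.
rewrite dsumMl mulr_sumr; apply: eq_bigr => P _.
by rewrite sum_ipp_plane_sum; ring.
Qed.

Lemma norm_line_sum : \sum_l hl l ^+ 2 = (q ^+ 2 + q) * nh.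
Proof.
transitivity (dsum (fun P P' => h P * h P' * (1 + (q ^+ 2 + q) * (P == P')%:R))).
  under eq_bigr => s _ do rewrite expr2 {1}/hl mulr_suml.
  rewrite exchange_big /=; apply: eq_bigr => P _.
  under eq_bigr => s _ do rewrite mulr_sumr.
  rewrite exchange_big /=; apply: eq_bigr => P' _.
  rewrite -sum_ipl_join mulr_sumr; apply: eq_bigr => s _; ring.
by rewrite (@sum_sqr_eq _ h 1 (q ^+ 2 + q)) // sum_pt_avg expr0n mulr0 add0r.
Qed.

(** Pythagoras: the subtracted component is an orthogonal projection of squared norm
    [(q ^+ 2 + 1) * nh]. *)
Lemma norm_pure_part :
  dsum (fun P l => pure_part P l ^+ 2) = nu - (q ^+ 2 + 1) * nh.
Proof.
have q2 := gq_ge2 G.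
have m0 : q + 1 != 0 by lra.
rewrite (eq_dsum (H := fun P l => u P l ^+ 2 + (- 2) * (h P * u P l)
   + 2 / (q + 1) * (hl l * u P l) + h P ^+ 2 * i P l
   + - (2 / (q + 1)) * (hl l * (i P l * h P))
   + (q + 1)^-1 ^+ 2 * (hl l ^+ 2 * i P l))).
  rewrite !dsumD !dsumZ !dsumMl !dsumMr.
  rewrite (eq_bigr (fun P => (q ^+ 2 + 1) * h P ^+ 2)); last first.
    by move=> P _; rewrite [\sum_l _]pt_sumE; ring.
  rewrite [\sum_l hl l * _]big1 => [|l _]; last by rewrite u_line mulr0.
  rewrite -mulr_sumr.
  under [\sum_P h P ^+ 2 * _]eq_bigr => P _ do rewrite sum_ipl_r.
  under [\sum_l hl l * _]eq_bigr => l _ do rewrite -/(hl l) -expr2.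
  under [\sum_l hl l ^+ 2 * _]eq_bigr => l _ do rewrite sum_ipl_l.
  rewrite -!mulr_suml norm_line_sum.
  by field.
move=> P l; rewrite /pure_part.
have hi := ipl_idem P l; have hu := u_flag P l.
transitivity (u P l ^+ 2 - 2 * (i P l * u P l) * (h P - hl l / (q + 1))
   + (i P l * i P l) * (h P - hl l / (q + 1)) ^+ 2); first by ring.
by rewrite hi hu; field.
Qed.

(** This is [norm_pp_sum] for the pure part, whose sum over the lines through any point is zero, so
    that only the factor [q] remains. *)
Lemma norm_pp_pure :
  dsum (fun P s => pp_pure P s ^+ 2) = q * (nu - (q ^+ 2 + 1) * nh).
Proof.
have q2 := gq_ge2 G.
have m0 : q + 1 != 0 by lra.
set al := (q ^+ 2 + q + 1) / (q + 1); set be := (q + 1)^-1.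
rewrite (eq_dsum (H := fun P s => uj P s ^+ 2 + (- 2 * al) * (h P * uj P s)
   + (2 * be) * (hs s * uj P s) + al ^+ 2 * (h P ^+ 2 * e P s)
   + (- 2 * al * be) * (hs s * (e P s * h P))
   + be ^+ 2 * (hs s ^+ 2 * e P s))).
  rewrite !dsumD !dsumZ !dsumMl !dsumMr norm_pp_sum.
  rewrite [\sum_P h P * _](eq_bigr (fun P => (q + 1) * (q ^+ 2 + 1) * h P ^+ 2)); last first.
    by move=> P _; rewrite sum_pp_sum_plane pt_sumE; ring.
  rewrite [\sum_s hs s * _]big1 => [|s _]; last by rewrite sum_pp_sum_point mulr0.
  rewrite -mulr_sumr.
  under [\sum_P h P ^+ 2 * _]eq_bigr => P _ do rewrite sum_ipp_r.
  under [\sum_s hs s * _]eq_bigr => s _ do rewrite -/(hs s) -expr2.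
  under [\sum_s hs s ^+ 2 * _]eq_bigr => s _ do rewrite (@sum_ipp_r (dual G)).
  rewrite -!mulr_suml norm_plane_sum /al /be.
  by rewrite /gq /=; field.
move=> P s; rewrite /pp_pure -/al -/be.
have he := ipp_idem P s; have hu := pp_sum_flag P s.
transitivity (uj P s ^+ 2 - 2 * (e P s * uj P s) * (al * h P - be * hs s)
   + (e P s * e P s) * (al * h P - be * hs s) ^+ 2); first by ring.
by rewrite he hu; ring.
Qed.

End FlagFunction.

(** * A sum-of-squares bound for the form coupling point and plane deviations *)

Section SkewForm.

Variables (G : space3) (u : point G -> line G -> rat) (w : plane G -> line G -> rat).
Hypothesis u_flag : forall P l, ipl P l * u P l = u P l.
Hypothesis u_line : forall l, \sum_P u P l = 0.
Hypothesis w_flag : forall s l, ilp l s * w s l = w s l.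
Hypothesis w_line : forall l, \sum_s w s l = 0.

Local Notation q := (gq G).
Local Notation i := ipl.
Local Notation j := ilp.
Local Notation e := ipp.
Local Notation D := isk.
Local Notation U := (pt_sum u).
Local Notation W := (@pt_sum (dual G) w).
Local Notation h := (pt_avg u).
Local Notation k := (@pt_avg (dual G) w).
Local Notation hs := (plane_sum u).
Local Notation kP := (@plane_sum (dual G) w).
Local Notation uj := (pp_sum u).
Local Notation wi := (@pp_sum (dual G) w).
Local Notation S := (dsum (fun P s => h P * k s * e P s)).
Local Notation T := (dsum (fun P s => uj P s * wi s P)).

(* For skew l, l' and a plane s through l, the only nonzero term of the inner   *)
(* sum has P equal to the common point of l' and s.                             *)
Definition skew_form :=
  dsum (fun l l' => D l l' * dsum (fun P s => w s l * u P l' * e P s)).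

Lemma skew_flags P l s l' :
  D l l' * (w s l * u P l' * e P s) =
  e P s * (w s l - i P l * w s l) * (u P l' - u P l' * j l' s).
Proof.
rewrite -(w_flag s l) -(u_flag P l') /D /i /j /e.
case: (boolP (on_lp l s)) => [ls|]; last by rewrite !(mul0r, mulr0, subrr).
case: (boolP (on_pl P l')) => [Pl'|]; last by rewrite !(mul0r, mulr0, subrr).
case: (boolP (on_pp P s)) => [Ps|]; last by rewrite !(mul0r, mulr0).
rewrite (skew_coplanar ls Pl' Ps).
by case: on_pl; case: on_lp => /=; ring.
Qed.

Lemma skew_form_pp :
  skew_form = dsum (fun P s => e P s * (W s - wi s P) * (U P - uj P s)).
Proof.
transitivity (dsum (fun l l' => dsum (fun P s =>
  e P s * (w s l - i P l * w s l) * (u P l' - u P l' * j l' s)))).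
  by apply: eq_dsum => l l'; rewrite -dsumZ; apply: eq_dsum => P s; apply: skew_flags.
rewrite /dsum; under eq_bigr => l _ do rewrite exchange_big /=.
rewrite exchange_big /=; apply: eq_bigr => P _.
under eq_bigr => l _ do rewrite exchange_big /=.
rewrite exchange_big /=; apply: eq_bigr => s _.
under eq_bigr => l _ do rewrite -mulr_sumr.
rewrite -mulr_suml -mulr_sumr /W /U /wi /uj !sumrB.
congr (_ * (_ - _) * _); apply: eq_bigr => l _.
by rewrite mulrC.
Qed.

(** By [skew_coplanar] the form factorizes for each incident pair [P], [s]. Expanding the product,
    the mixed terms vanish because [pp_sum] has sum zero over the points (dually, over the
    planes). *)
Lemma skew_formE : skew_form = (q ^+ 2 + 1) ^+ 2 * S + T.
Proof.
rewrite skew_form_pp [LHS](eq_dsum (H := fun P s => (q ^+ 2 + 1) ^+ 2 * (h P * k s * e P s)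
  + (-1) * (W s * uj P s) + (-1) * (U P * wi s P) + uj P s * wi s P)).
  have UH0 : \sum_P U P * \sum_s wi s P = 0.
    by apply: big1 => P _; rewrite (@sum_pp_sum_point (dual G) w w_line) mulr0.
  have WG0 : \sum_s W s * \sum_P uj P s = 0.
    by apply: big1 => s _; rewrite sum_pp_sum_point // mulr0.
  by rewrite !dsumD !dsumZ dsumMl dsumMr UH0 WG0; ring.
move=> P s.
transitivity (e P s * (U P * W s) - W s * (e P s * uj P s) - U P * (e P s * wi s P)
   + (e P s * uj P s) * wi s P); first by ring.
rewrite (@pp_sum_flag (dual G) w w_flag s P) (pp_sum_flag u_flag).
rewrite (pt_sumE u P) (@pt_sumE (dual G) w s) /gq /=.
by ring.
Qed.

Lemma sum_pt_avg_dual : \sum_P h P * kP P = S.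
Proof.
apply: eq_bigr => P _; rewrite mulr_sumr; apply: eq_bigr => s _.
by rewrite -[@ipp (dual G) s P]/(e P s); ring.
Qed.

Lemma sum_plane_avg : \sum_s k s * hs s = S.
Proof.
rewrite dsumC; apply: eq_bigr => s _; rewrite mulr_sumr; apply: eq_bigr => P _.
by ring.
Qed.

Lemma dsum_pp_pure :
  dsum (fun P s => pp_pure u P s * @pp_pure (dual G) w s P) = (q ^+ 2 + 1) * S + T.
Proof.
have q2 := gq_ge2 G.
have m0 : q + 1 != 0 by lra.
set al := (q ^+ 2 + q + 1) / (q + 1); set be := (q + 1)^-1.
rewrite [LHS](eq_dsum (H := fun P s => uj P s * wi s P + (- al) * (k s * uj P s)
  + be * (kP P * uj P s) + (- al) * (h P * wi s P) + be * (hs s * wi s P)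
  + al ^+ 2 * (h P * k s * e P s) + (- al * be) * (h P * kP P * e P s)
  + (- al * be) * (k s * hs s * e P s) + be ^+ 2 * (kP P * (e P s * hs s)))).
  rewrite !dsumD !dsumZ !dsumMl !dsumMr.
  have -> : \sum_s k s * \sum_P uj P s = 0.
    by apply: big1 => s _; rewrite sum_pp_sum_point // mulr0.
  have -> : \sum_P h P * \sum_s wi s P = 0.
    by apply: big1 => P _; rewrite (@sum_pp_sum_point (dual G) w w_line) mulr0.
  have -> : \sum_P kP P * \sum_s uj P s = (q + 1) * (q ^+ 2 + 1) * S.
    rewrite -sum_pt_avg_dual mulr_sumr; apply: eq_bigr => P _.
    by rewrite sum_pp_sum_plane pt_sumE; ring.
  have -> : \sum_s hs s * \sum_P wi s P = (q + 1) * (q ^+ 2 + 1) * S.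
    rewrite -sum_plane_avg mulr_sumr; apply: eq_bigr => s _.
    rewrite (@sum_pp_sum_plane (dual G) w s) (@pt_sumE (dual G) w s).
    by rewrite /gq /=; ring.
  have -> : \sum_P h P * kP P * \sum_s e P s = (q ^+ 2 + q + 1) * S.
    under eq_bigr => P _ do rewrite sum_ipp_r.
    by rewrite -mulr_suml sum_pt_avg_dual mulrC.
  have -> : \sum_s k s * hs s * \sum_P e P s = (q ^+ 2 + q + 1) * S.
    under eq_bigr => s _ do rewrite (@sum_ipp_r (dual G) s).
    by rewrite -mulr_suml sum_plane_avg mulrC.
  have -> : \sum_P kP P * \sum_s e P s * hs s = q ^+ 2 * S.
    under eq_bigr => P _ do rewrite (sum_ipp_plane_sum u_line).
    rewrite -sum_pt_avg_dual mulr_sumr; apply: eq_bigr => P _; ring.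
  by rewrite /al /be; field.
move=> P s; rewrite /pp_pure -[gq (dual G)]/q -/al -/be -[@ipp (dual G) s P]/(e P s).
have he := ipp_idem P s; have hu := pp_sum_flag u_flag P s.
have hw : e P s * wi s P = wi s P := @pp_sum_flag (dual G) w w_flag s P.
transitivity (uj P s * wi s P - (e P s * uj P s) * (al * k s - be * kP P)
   - (e P s * wi s P) * (al * h P - be * hs s)
   + (e P s * e P s) * ((al * h P - be * hs s) * (al * k s - be * kP P))); first by ring.
by rewrite he hu hw; ring.
Qed.

(** [skew_formE] and [dsum_pp_pure] split the form into [q ^+ 2 * (q ^+ 2 + 1) * S] plus the inner
    product of the two [pp_pure]. Each part completes to a square. The pure parts need only the
    factor [q] of the available [q ^+ 3], and the positive remainder [q ^+ 3 - q] forces them to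
    vanish in the case of equality. *)
Lemma skew_form_sos :
  q ^+ 3 * (dsum (fun P l => u P l ^+ 2) + dsum (fun s l => w s l ^+ 2))
    - 2 * skew_form =
  q * (q ^+ 2 + 1) * \sum_s (hs s - q * k s) ^+ 2
  + dsum (fun P s => (pp_pure u P s - @pp_pure (dual G) w s P) ^+ 2)
  + (q ^+ 3 - q) * (dsum (fun P l => pure_part u P l ^+ 2)
                    + dsum (fun s l => @pure_part (dual G) w s l ^+ 2)).
Proof.
rewrite (eq_bigr (fun s => hs s ^+ 2 - 2 * q * (k s * hs s) + q ^+ 2 * k s ^+ 2));
  last by move=> s _; ring.
rewrite big_split sumrB -!mulr_sumr sum_plane_avg (norm_plane_sum u_line).
rewrite (eq_dsum (F := fun P s => (pp_pure u P s - _) ^+ 2)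
  (H := fun P s => pp_pure u P s ^+ 2 + @pp_pure (dual G) w s P ^+ 2
       + (- 2) * (pp_pure u P s * @pp_pure (dual G) w s P))); last by move=> P s; ring.
rewrite !dsumD dsumZ dsum_pp_pure norm_pp_pure // norm_pure_part //.
rewrite (@norm_pure_part (dual G)) //.
rewrite (dsumC (fun P s => @pp_pure (dual G) w s P ^+ 2)) (@norm_pp_pure (dual G)) //.
rewrite skew_formE /gq /=.
by ring.
Qed.

End SkewForm.

(** * Equality in the bound for sets without opposite chambers *)

Section ChamberSet.

Variables (G : space3) (chi : point G -> line G -> plane G -> bool).
Hypothesis chi_flag : forall P l s, chi P l s -> on_pl P l && on_lp l s.

Local Notation q := (gq G).
Local Notation i := ipl.
Local Notation j := ilp.
Local Notation e := ipp.
Local Notation D := isk.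

Definition ichi P l s : rat := (chi P l s)%:R.
Local Notation c := ichi.
Definition line_wt l := dsum (fun P s => c P l s).
Local Notation x := line_wt.
Definition pl_wt P l := \sum_s c P l s.
Definition lp_wt s l := \sum_P c P l s.
Definition pl_dev P l := pl_wt P l - i P l * (x l / (q + 1)).
Local Notation u := pl_dev.
Definition lp_dev s l := lp_wt s l - j l s * (x l / (q + 1)).
Local Notation w := lp_dev.
(** The interaction term of a two-way decomposition: on each line, the indicator minus its mean and
    its point and plane effects, so that all row and column sums are zero. *)
Definition residual P l s :=
  c P l s - u P l * j l s / (q + 1) - i P l * w s l / (q + 1)
    - i P l * j l s * (x l / (q + 1) ^+ 2).
Local Notation z := residual.

Let m0 : q + 1 != 0.
Proof. by have := gq_ge2 G; lra. Qed.

Lemma ichi_ipl P l s : i P l * c P l s = c P l s.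
Proof.
rewrite /c /i; case: (boolP (chi P l s)) => [/chi_flag/andP[-> _]|_];
by rewrite ?mulr1 ?mulr0.
Qed.

Lemma ichi_ilp P l s : j l s * c P l s = c P l s.
Proof.
rewrite /c /j; case: (boolP (chi P l s)) => [/chi_flag/andP[_ ->]|_];
by rewrite ?mulr1 ?mulr0.
Qed.

Lemma pl_dev_flag P l : i P l * u P l = u P l.
Proof.
rewrite /u mulrBr [X in _ - X]mulrA ipl_idem; congr (_ - _).
by rewrite mulr_sumr; apply: eq_bigr => s _; rewrite ichi_ipl.
Qed.

Lemma lp_dev_flag s l : j l s * w s l = w s l.
Proof.
rewrite /w mulrBr [X in _ - X]mulrA ilp_idem; congr (_ - _).
by rewrite mulr_sumr; apply: eq_bigr => P _; rewrite ichi_ilp.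
Qed.

Lemma residual_ipl P l s : i P l * z P l s = z P l s.
Proof.
have hc := ichi_ipl P l s; have hu := pl_dev_flag P l; have hi := ipl_idem P l.
transitivity (i P l * c P l s - (i P l * u P l) * j l s / (q + 1)
  - (i P l * i P l) * w s l / (q + 1)
  - (i P l * i P l) * j l s * (x l / (q + 1) ^+ 2)); first by rewrite /z; ring.
by rewrite hc hu hi.
Qed.

Lemma residual_ilp P l s : j l s * z P l s = z P l s.
Proof.
have hc := ichi_ilp P l s; have hw := lp_dev_flag s l; have hj := ilp_idem l s.
transitivity (j l s * c P l s - (j l s * j l s) * u P l / (q + 1)
  - i P l * (j l s * w s l) / (q + 1)
  - (j l s * j l s) * i P l * (x l / (q + 1) ^+ 2)); first by rewrite /z; ring.
by rewrite hc hw hj /z; ring.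
Qed.

Lemma sum_pl_dev l : \sum_P u P l = 0.
Proof. by rewrite sumrB -mulr_suml sum_ipl_l mulrC divfK // subrr. Qed.

Lemma sum_lp_dev l : \sum_s w s l = 0.
Proof.
rewrite sumrB -mulr_suml sum_ilp_r mulrC divfK // [\sum_s _]exchange_big.
by rewrite /= subrr.
Qed.

Lemma sum_residual_plane P l : \sum_s z P l s = 0.
Proof.
rewrite !sumrB -!mulr_suml -!mulr_sumr sum_ilp_r sum_lp_dev -/(pl_wt P l).
by rewrite /u; field.
Qed.

Lemma sum_residual_point l s : \sum_P z P l s = 0.
Proof.
rewrite !sumrB -!mulr_suml sum_ipl_l sum_pl_dev -/(lp_wt s l).
by rewrite /w; field.
Qed.

Lemma sum_pl_dev_wt l : \sum_P u P l * pl_wt P l = \sum_P u P l ^+ 2.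
Proof.
apply/eqP; rewrite -subr_eq0 -sumrB.
under eq_bigr => P _.
  have -> : u P l * pl_wt P l - u P l ^+ 2 = i P l * u P l * (x l / (q + 1)).
    by rewrite /u; ring.
  rewrite pl_dev_flag; over.
by rewrite -mulr_suml sum_pl_dev mul0r.
Qed.

Lemma sum_lp_dev_wt l : \sum_s w s l * lp_wt s l = \sum_s w s l ^+ 2.
Proof.
apply/eqP; rewrite -subr_eq0 -sumrB.
under eq_bigr => s _.
  have -> : w s l * lp_wt s l - w s l ^+ 2 = j l s * w s l * (x l / (q + 1)).
    by rewrite /w; ring.
  rewrite lp_dev_flag; over.
by rewrite -mulr_suml sum_lp_dev mul0r.
Qed.

(** Pythagoras for the orthogonal decomposition on one line; the indicator is idempotent, so its
    squared norm is [x l]. *)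
Lemma norm_residual l :
  dsum (fun P s => z P l s ^+ 2) = x l - (\sum_P u P l ^+ 2) / (q + 1)
    - (\sum_s w s l ^+ 2) / (q + 1) - x l ^+ 2 / (q + 1) ^+ 2.
Proof.
rewrite (eq_dsum (H := fun P s => c P l s
  + (- (q + 1)^-1) * (u P l * c P l s) + (- (q + 1)^-1) * (w s l * c P l s)
  + (- (x l / (q + 1) ^+ 2)) * c P l s
  + (- (q + 1)^-1) * (u P l * z P l s) + (- (q + 1)^-1) * (w s l * z P l s)
  + (- (x l / (q + 1) ^+ 2)) * z P l s)).
  rewrite !dsumD !dsumZ !dsumMl !dsumMr.
  have -> : dsum (fun P s => z P l s) = 0.
    by rewrite /dsum big1 // => P _; exact: sum_residual_plane.
  have -> : \sum_P u P l * \sum_s z P l s = 0.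
    by rewrite big1 // => P _; rewrite sum_residual_plane mulr0.
  have -> : \sum_s w s l * \sum_P z P l s = 0.
    by rewrite big1 // => s _; rewrite sum_residual_point mulr0.
  by rewrite sum_pl_dev_wt sum_lp_dev_wt -/(x l); field.
move=> P s.
have ic := ichi_ipl P l s; have jc := ichi_ilp P l s.
have iz := residual_ipl P l s; have jz := residual_ilp P l s.
have cc : c P l s * c P l s = c P l s.
  by rewrite /c; case: chi; rewrite ?mulr1 ?mulr0.
transitivity (c P l s * c P l s
  - (q + 1)^-1 * (u P l * (j l s * c P l s)) - (q + 1)^-1 * (w s l * (i P l * c P l s))
  - (x l / (q + 1) ^+ 2) * (i P l * (j l s * c P l s))
  - (q + 1)^-1 * (u P l * (j l s * z P l s)) - (q + 1)^-1 * (w s l * (i P l * z P l s))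
  - (x l / (q + 1) ^+ 2) * (i P l * (j l s * z P l s))).
  set A := u P l * j l s / (q + 1) + i P l * w s l / (q + 1)
    + i P l * j l s * (x l / (q + 1) ^+ 2).
  have zE : z P l s = c P l s - A by rewrite /z /A; ring.
  transitivity (c P l s * (c P l s - A) - A * z P l s);
    first by rewrite -zE [in LHS]expr2 {1}zE; ring.
  by rewrite /A; ring.
by rewrite cc jc ic jz iz; ring.
Qed.

Lemma residual_skew P s k k' : skew k k' -> z P k s = 0 \/ i P k' = 0 /\ j k' s = 0.
Proof.
move=> skk'; case: (boolP (on_pl P k)) => Pk; last first.
  by left; rewrite -residual_ipl /i (negPf Pk) mul0r.
case: (boolP (on_lp k s)) => ks; last first.
  by left; rewrite -residual_ilp /j (negPf ks) mul0r.
right; rewrite /i /j; split.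
  by case: (boolP (on_pl P k')) => // /(pl_not_skew Pk); rewrite skk'.
by case: (boolP (on_lp k' s)) => // /(lp_not_skew ks); rewrite skk'.
Qed.

(** For [P] on [l], [s] through [l], and [l] skew to [l'], a single term survives: [s'] is the plane
    on [l'] and [P], and [P'] is the point where [l'] meets [s]. So this is the residual on [l']
    transported to the chamber [(P, l, s)]. *)
Definition residual_opp l' P s :=
  dsum (fun P' s' => z P' l' s' * (e P s' * e P' s)).

(** * Opposite pairs of chambers on two fixed skew lines *)

Section SkewPair.

Variables l l' : line G.
Hypothesis skew_ll' : skew l l'.

Let skew_l'l : skew l' l.
Proof. by rewrite skew_sym. Qed.

Lemma skew_ipl P : i P l * i P l' = 0.
Proof.
rewrite /i; case: (boolP (on_pl P l)) => [Pl|_]; last by rewrite mul0r.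
case: (boolP (on_pl P l')) => [Pl'|_]; last by rewrite mulr0.
by have := pl_not_skew Pl Pl'; rewrite skew_ll'.
Qed.

Lemma skew_ilp s : j l s * j l' s = 0.
Proof.
rewrite /j; case: (boolP (on_lp l s)) => [ls|_]; last by rewrite mul0r.
case: (boolP (on_lp l' s)) => [l's|_]; last by rewrite mulr0.
by have := lp_not_skew ls l's; rewrite skew_ll'.
Qed.

Let ue s := \sum_P u P l' * e P s.
Let we P := \sum_s w s l' * e P s.
Local Notation ze := (residual_opp l').

(** The left side counts the chambers on [l'] opposite to [(P, l, s)]. As deviations sum to zero,
    [1 - e] acts on them as [- e]; as the residual has zero marginals, only the product of the two
    incidences acts on it. *)
Lemma sum_skew_line P s : on_pl P l -> on_lp l s ->
  dsum (fun P' s' => c P' l' s' * ((1 - e P s') * (1 - e P' s))) =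
  q ^+ 2 * (x l' / (q + 1) ^+ 2) - q / (q + 1) * (ue s + we P) + ze P s.
Proof.
move=> Pl ls.
have iPl' : i P l' = 0 by have := skew_ipl P; rewrite /i Pl mul1r.
have jsl' : j l' s = 0 by have := skew_ilp s; rewrite /j ls mul1r.
have sum_j : \sum_s' j l' s' * (1 - e P s') = q.
  transitivity (\sum_s' (j l' s' - j l' s' * e P s')).
    by apply: eq_bigr => s' _; ring.
  by rewrite sumrB sum_ilp_r sum_ilp_ipp iPl'; ring.
have sum_i : \sum_P' i P' l' * (1 - e P' s) = q.
  transitivity (\sum_P' (i P' l' - i P' l' * e P' s)).
    by apply: eq_bigr => P' _; ring.
  by rewrite sumrB sum_ipl_l sum_ipl_ipp jsl'; ring.
have sum_u : \sum_P' u P' l' * (1 - e P' s) = - ue s.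
  transitivity (\sum_P' (u P' l' - u P' l' * e P' s)).
    by apply: eq_bigr => P' _; ring.
  by rewrite sumrB sum_pl_dev sub0r.
have sum_w : \sum_s' w s' l' * (1 - e P s') = - we P.
  transitivity (\sum_s' (w s' l' - w s' l' * e P s')).
    by apply: eq_bigr => s' _; ring.
  by rewrite sumrB sum_lp_dev sub0r.
rewrite [LHS](eq_dsum (H := fun P' s' =>
   (q + 1)^-1 * (u P' l' * (1 - e P' s) * (j l' s' * (1 - e P s')))
 + (q + 1)^-1 * (i P' l' * (1 - e P' s) * (w s' l' * (1 - e P s')))
 + x l' / (q + 1) ^+ 2 * (i P' l' * (1 - e P' s) * (j l' s' * (1 - e P s')))
 + z P' l' s' * (e P s' * e P' s)
 + (1 - e P s') * z P' l' s' + (-1) * (e P' s * z P' l' s'))).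
  rewrite !dsumD !dsumZ !dsum_prod dsumMr dsumMl sum_j sum_i sum_u sum_w -/(ze P s).
  rewrite [\sum_s' (1 - e P s') * _]big1 => [|s' _]; last first.
    by rewrite sum_residual_point mulr0.
  rewrite [\sum_P' e P' s * \sum_s' _]big1 => [|P' _]; last first.
    by rewrite sum_residual_plane mulr0.
  by field.
move=> P' s'.
have -> : c P' l' s' = z P' l' s' + u P' l' * j l' s' / (q + 1)
  + i P' l' * w s' l' / (q + 1) + i P' l' * j l' s' * (x l' / (q + 1) ^+ 2).
  by rewrite /z; ring.
by field.
Qed.

(** Summing [e P' s] over the planes through [l] gives [1 + q * i P' l]. Skewness makes [i P' l]
    zero wherever the residual on [l'] is nonzero, and the zero point sums of the residual finish.
    With [sum_ipl_ze] this says that transport preserves zero marginals. *)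
Lemma sum_ilp_ze P : i P l * \sum_s j l s * ze P s = 0.
Proof.
have -> : \sum_s j l s * ze P s =
    dsum (fun P' s' => e P s' * (z P' l' s' * (1 + q * i P' l))).
  under eq_bigr => s _ do rewrite mulr_sumr.
  rewrite exchange_big /=; apply: eq_bigr => P' _.
  under eq_bigr => s _ do rewrite mulr_sumr.
  rewrite exchange_big /=; apply: eq_bigr => s' _.
  by rewrite -sum_ilp_ipp !mulr_sumr; apply: eq_bigr => s _; ring.
rewrite dsumMr [\sum_s' _]big1 ?mulr0 // => s' _.
rewrite (eq_bigr (fun P' => z P' l' s')) ?sum_residual_point ?mulr0 // => P' _.
by case: (residual_skew P' s' skew_l'l) => [->|[-> _]]; ring.
Qed.

Lemma sum_ipl_ze s : \sum_P i P l * ze P s = 0.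
Proof.
have -> : \sum_P i P l * ze P s =
    dsum (fun P' s' => e P' s * (z P' l' s' * (1 + q * j l s'))).
  under eq_bigr => P _ do rewrite mulr_sumr.
  rewrite exchange_big /=; apply: eq_bigr => P' _.
  under eq_bigr => P _ do rewrite mulr_sumr.
  rewrite exchange_big /=; apply: eq_bigr => s' _.
  by rewrite -sum_ipl_ipp !mulr_sumr; apply: eq_bigr => P _; ring.
rewrite dsumMl big1 // => P' _.
rewrite (eq_bigr (fun s' => z P' l' s')) ?sum_residual_plane ?mulr0 // => s' _.
by case: (residual_skew P' s' skew_l'l) => [->|[_ ->]]; ring.
Qed.

Lemma sum_skew_pair :
  dsum (fun P s => c P l s *
    dsum (fun P' s' => c P' l' s' * ((1 - e P s') * (1 - e P' s)))) =
  (q / (q + 1)) ^+ 2 * (x l * x l')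
  - q / (q + 1) * (dsum (fun P' s => w s l * u P' l' * e P' s)
                 + dsum (fun P s' => w s' l' * u P l * e P s'))
  + dsum (fun P s => z P l s * ze P s).
Proof.
(* The transported residual has zero marginals on [l], hence is orthogonal to all parts of [c]
   except [z]. *)
have chi_z : dsum (fun P s => c P l s * ze P s) = dsum (fun P s => z P l s * ze P s).
  rewrite [LHS](eq_dsum (H := fun P s => z P l s * ze P s
    + (q + 1)^-1 * (u P l * (j l s * ze P s))
    + (w s l / (q + 1) + j l s * (x l / (q + 1) ^+ 2)) * (i P l * ze P s))).
    rewrite !dsumD !dsumZ dsumMl dsumMr.
    rewrite [\sum_P u P l * _]big1 => [|P _]; last first.
      by rewrite -pl_dev_flag -mulrA mulrCA sum_ilp_ze mulr0.
    rewrite [\sum_s _ * \sum_P i P l * _]big1 => [|s _]; last by rewrite sum_ipl_ze mulr0.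
    by rewrite mulr0 !addr0.
  by move=> P s; rewrite /z; field.
have wt_ue : \sum_s lp_wt s l * ue s = dsum (fun P' s => w s l * u P' l' * e P' s).
  transitivity (\sum_s (w s l * ue s + x l / (q + 1) * (j l s * ue s))).
    by apply: eq_bigr => s _; rewrite /w; field.
  rewrite big_split -mulr_sumr /= [X in _ * X](_ : _ = 0).
    rewrite mulr0 addr0 dsumC; apply: eq_bigr => s _.
    by rewrite mulr_sumr; apply: eq_bigr => P' _; ring.
  under eq_bigr => s _ do rewrite mulr_sumr.
  rewrite exchange_big /= -[RHS](sum_pl_dev l'); apply: eq_bigr => P' _.
  transitivity (u P' l' * \sum_s j l s * e P' s).
    by rewrite mulr_sumr; apply: eq_bigr => s _; ring.
  rewrite sum_ilp_ipp -(pl_dev_flag P' l') mulrDr mulr1.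
  rewrite [X in _ + X](_ : _ = i P' l * i P' l' * (q * u P' l')); last ring.
  by rewrite skew_ipl mul0r addr0.
have wt_we : \sum_P pl_wt P l * we P = dsum (fun P s' => w s' l' * u P l * e P s').
  transitivity (\sum_P (u P l * we P + x l / (q + 1) * (i P l * we P))).
    by apply: eq_bigr => P _; rewrite /u; field.
  rewrite big_split -mulr_sumr /= [X in _ * X](_ : _ = 0).
    rewrite mulr0 addr0; apply: eq_bigr => P _.
    by rewrite mulr_sumr; apply: eq_bigr => s' _; ring.
  under eq_bigr => P _ do rewrite mulr_sumr.
  rewrite exchange_big /= -[RHS](sum_lp_dev l'); apply: eq_bigr => s' _.
  transitivity (w s' l' * \sum_P i P l * e P s').
    by rewrite mulr_sumr; apply: eq_bigr => P _; ring.
  rewrite sum_ipl_ipp -(lp_dev_flag s' l') mulrDr mulr1.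
  rewrite [X in _ + X](_ : _ = j l s' * j l' s' * (q * w s' l')); last ring.
  by rewrite skew_ilp mul0r addr0.
rewrite -chi_z -wt_ue -wt_we.
rewrite [LHS](eq_dsum (H := fun P s => q ^+ 2 * (x l' / (q + 1) ^+ 2) * c P l s
  + (- (q / (q + 1))) * (ue s * c P l s) + (- (q / (q + 1))) * (we P * c P l s)
  + c P l s * ze P s)).
  rewrite !dsumD !dsumZ dsumMl dsumMr -/(x l).
  under [\sum_s lp_wt s l * _]eq_bigr => s _ do rewrite mulrC.
  under [\sum_P pl_wt P l * _]eq_bigr => P _ do rewrite mulrC.
  by rewrite /lp_wt /pl_wt; field.
move=> P s; rewrite /c; case: (boolP (chi P l s)) => [/chi_flag/andP[Pl ls]|_].
  by rewrite sum_skew_line //; ring.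
by rewrite /=; ring.
Qed.

(** For skew [l], [l'] each chamber on [l] is matched with exactly one chamber on [l'], so in the
    expansion each squared residual occurs once and the mixed terms form the inner product with
    [ze]. *)
Lemma sum_residual_sqr :
  dsum (fun P s => dsum (fun P' s' =>
    i P l * j l s * i P' l' * j l' s' * e P s' * e P' s
      * (z P l s + z P' l' s') ^+ 2)) =
  dsum (fun P s => z P l s ^+ 2) + dsum (fun P s => z P l' s ^+ 2)
  + 2 * dsum (fun P s => z P l s * ze P s).
Proof.
transitivity (dsum (fun P s =>
     z P l s ^+ 2 * dsum (fun P' s' => i P' l' * e P' s * (j l' s' * e P s'))
   + dsum (fun P' s' => z P' l' s' ^+ 2 * (i P l * e P s' * (j l s * e P' s)))
   + 2 * (z P l s * ze P s))).
  apply: eq_dsum => P s; rewrite /ze -!dsumZ -!dsumD; apply: eq_dsum => P' s'.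
  transitivity (i P l * (j l s * (i P' l' * (j l' s' * (e P s' * e P' s *
    (z P l s ^+ 2 + z P' l' s' ^+ 2 + 2 * (z P l s * z P' l' s'))))))); first by ring.
  have := residual_ipl P l s; have := residual_ilp P l s.
  have := residual_ipl P' l' s'; have := residual_ilp P' l' s'.
  rewrite /i /j; case: (on_pl P l); case: (on_lp l s);
    case: (on_pl P' l'); case: (on_lp l' s') => /=;
    rewrite ?mul0r ?mul1r => hz1 hz2 hz3 hz4;
    rewrite -?hz1 -?hz2 -?hz3 -?hz4; ring.
rewrite !dsumD !dsumZ; congr (_ + _ + _).
  apply: eq_dsum => P s; rewrite dsum_prod sum_ipl_ipp sum_ilp_ipp.
  by case: (residual_skew P s skew_ll') => [->|[-> ->]]; ring.
rewrite dsum_exchange; apply: eq_dsum => P' s'.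
rewrite dsumZ dsum_prod sum_ipl_ipp sum_ilp_ipp.
by case: (residual_skew P' s' skew_l'l) => [->|[-> ->]]; ring.
Qed.

End SkewPair.

(** * Summation over all pairs of skew lines, and the case of equality *)

Hypothesis chi_free : forall P l s P' l' s', chi P l s -> chi P' l' s' ->
  skew l l' -> on_pp P s' || on_pp P' s.

Local Notation t := (\sum_l x l).
Local Notation M := (skew_form u w).
Local Notation zz l l' := (dsum (fun P s => z P l s * residual_opp l' P s)).

Lemma sum_skew_free l l' :
  D l l' * dsum (fun P s => c P l s *
    dsum (fun P' s' => c P' l' s' * ((1 - e P s') * (1 - e P' s)))) = 0.
Proof.
rewrite /D; case: (boolP (skew l l')) => skll'; last by rewrite mul0r.
rewrite dsum0 ?mulr0 // => P s; rewrite -dsumZ dsum0 // => P' s'.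
rewrite /c /e; case: (boolP (chi P l s)) => [cP|_]; last by rewrite mul0r.
case: (boolP (chi P' l' s')) => [cP'|_]; last by rewrite mul0r mulr0.
by case/orP: (chi_free cP cP' skll') => -> /=; ring.
Qed.

Lemma skew_total :
  (q / (q + 1)) ^+ 2 * dsum (fun l l' => D l l' * (x l * x l'))
  - 2 * (q / (q + 1)) * M + dsum (fun l l' => D l l' * zz l l') = 0.
Proof.
have M' : dsum (fun l l' => D l l' * dsum (fun P s => w s l' * u P l * e P s)) = M.
  by rewrite dsumC; apply: eq_dsum => l l'; rewrite isk_sym.
transitivity (dsum (fun l l' => D l l' * dsum (fun P s => c P l s *
    dsum (fun P' s' => c P' l' s' * ((1 - e P s') * (1 - e P' s))))));
  last by apply: dsum0 => l l'; exact: sum_skew_free.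
rewrite [RHS](eq_dsum (H := fun l l' =>
    (q / (q + 1)) ^+ 2 * (D l l' * (x l * x l'))
  + (- (q / (q + 1))) * (D l l' * dsum (fun P s => w s l * u P l' * e P s))
  + (- (q / (q + 1))) * (D l l' * dsum (fun P s => w s l' * u P l * e P s))
  + D l l' * zz l l')).
  by rewrite !dsumD !dsumZ M' -/M /skew_form; ring.
move=> l l'; rewrite /D; case: (boolP (skew l l')) => skll'; last by rewrite /=; ring.
by rewrite (sum_skew_pair skll'); ring.
Qed.

(* The smallest eigenvalue of the skewness graph on lines is -q^2; the square   *)
(* below removes from x the projection to its eigenspace, which is spanned      *)
(* modulo constants by the point pencils.                                       *)
Lemma sum_skew_line_wt :
  t ^+ 2 * q ^+ 2 <= (q ^+ 2 + q + 1) *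
    (dsum (fun l l' => D l l' * (x l * x l')) + q ^+ 2 * \sum_l x l ^+ 2).
Proof.
set X := fun P => \sum_l i P l * x l.
set Y := fun l => \sum_P i P l * X P.
have XE : \sum_P X P ^+ 2 =
    t ^+ 2 - dsum (fun l l' => D l l' * (x l * x l')) + q * \sum_l x l ^+ 2.
  transitivity (dsum (fun l l' => x l * x l' * (1 - D l l' + q * (l == l')%:R))).
    under eq_bigr => P _ do rewrite expr2 {1}/X mulr_suml.
    rewrite exchange_big /=; apply: eq_bigr => l _.
    under eq_bigr => P _ do rewrite mulr_sumr.
    rewrite exchange_big /=; apply: eq_bigr => l' _.
    rewrite -sum_ipl_common mulr_sumr; apply: eq_bigr => P _; ring.
  rewrite (eq_dsum (H := fun l l' => x l * x l' * (1 + q * (l == l')%:R)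
    + (-1) * (D l l' * (x l * x l')))); last by move=> l l'; ring.
  by rewrite dsumD dsumZ (@sum_sqr_eq _ x 1 q) //; ring.
have sumX : \sum_P X P = (q + 1) * t.
  rewrite exchange_big mulr_sumr; apply: eq_bigr => l _.
  by rewrite -mulr_suml sum_ipl_l.
have sumY : \sum_l Y l = (q ^+ 2 + q + 1) * ((q + 1) * t).
  rewrite exchange_big -sumX mulr_sumr; apply: eq_bigr => P _.
  by rewrite -mulr_suml sum_ipl_r.
have xY : \sum_l x l * Y l = \sum_P X P ^+ 2.
  under eq_bigr => l _ do rewrite mulr_sumr.
  rewrite exchange_big; apply: eq_bigr => P _ /=.
  by rewrite expr2 {2}/X mulr_suml; apply: eq_bigr => l _; ring.
have Y2 : \sum_l Y l ^+ 2 = ((q + 1) * t) ^+ 2 + (q ^+ 2 + q) * \sum_P X P ^+ 2.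
  transitivity (dsum (fun P P' => X P * X P' * (1 + (q ^+ 2 + q) * (P == P')%:R))).
    under eq_bigr => l _ do rewrite expr2 {1}/Y mulr_suml.
    rewrite exchange_big /=; apply: eq_bigr => P _.
    under eq_bigr => l _ do rewrite mulr_sumr.
    rewrite exchange_big /=; apply: eq_bigr => P' _.
    rewrite -sum_ipl_join mulr_sumr; apply: eq_bigr => l _; ring.
  by rewrite (@sum_sqr_eq _ X 1 (q ^+ 2 + q)) // sumX mul1r.
have q2 := gq_ge2 G.
(* On vectors of sum zero, [a * Y] is the projection to the span of the pencils, since [q ^+ 2 + q]
   is the nonzero eigenvalue there; [b] is chosen to cancel the constant component as well. *)
set a := (q ^+ 2 + q)^-1; set b := t / (q * (q ^+ 2 + q + 1)).
have : 0 <= \sum_l (x l - a * Y l + b) ^+ 2 by apply: sumr_ge0 => l _; exact: sqr_ge0.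
rewrite (eq_bigr (fun l => x l ^+ 2 + a ^+ 2 * Y l ^+ 2 + b ^+ 2 * 1
  + (- 2 * a) * (x l * Y l) + (2 * b) * x l + (- 2 * a * b) * Y l)); last first.
  by move=> l _; ring.
rewrite !big_split /= -!mulr_sumr card_line xY Y2 sumY XE.
move: (dsum _) (\sum_l x l ^+ 2) t @b => DD x2 tt b.
have q0 : q != 0 by lra.
have q10 : q + 1 != 0 by lra.
have r0 : q ^+ 2 + q + 1 != 0 by apply: lt0r_neq0; nra.
rewrite [X in 0 <= X](_ : _ = ((q ^+ 2 + q + 1) * (DD + q ^+ 2 * x2) - tt ^+ 2 * q ^+ 2)
   / (q * (q + 1) * (q ^+ 2 + q + 1))); last first.
  have q20 : q ^+ 2 + q != 0 by apply: lt0r_neq0; nra.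
  by rewrite /a /b; field; rewrite q0 q10 r0 q20.
rewrite pmulr_lge0 ?subr_ge0 // invr_gt0; nra.
Qed.

Hypothesis chi_large : (q + 1) ^+ 2 * (q ^+ 2 + q + 1) <= t.

Local Notation zsq l l' := (dsum (fun P s => dsum (fun P' s' =>
    i P l * j l s * i P' l' * j l' s' * e P s' * e P' s
      * (z P l s + z P' l' s') ^+ 2))).

Lemma zsq_ge0 l l' : 0 <= D l l' * zsq l l'.
Proof.
apply: mulr_ge0; first exact: ler0n.
apply: dsum_ge0 => P s; apply: dsum_ge0 => P' s'.
by apply: mulr_ge0 (sqr_ge0 _); do 5 (apply: mulr_ge0; last exact: ler0n); exact: ler0n.
Qed.

(** Each line is skew to [q ^+ 4] lines, so each residual norm is counted [q ^+ 4] times from either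
    side. *)
Lemma sum_zsq :
  dsum (fun l l' => D l l' * zsq l l') =
  2 * q ^+ 4 * (t - (dsum (fun P l => u P l ^+ 2) + dsum (fun s l => w s l ^+ 2)) / (q + 1)
                - (\sum_l x l ^+ 2) / (q + 1) ^+ 2)
  + 2 * dsum (fun l l' => D l l' * zz l l').
Proof.
set N := fun l => dsum (fun P s => z P l s ^+ 2).
have sumN : \sum_l N l = t
    - (dsum (fun P l => u P l ^+ 2) + dsum (fun s l => w s l ^+ 2)) / (q + 1)
    - (\sum_l x l ^+ 2) / (q + 1) ^+ 2.
  under eq_bigr => l _ do rewrite /N norm_residual.
  rewrite !sumrB -!mulr_suml (dsumC (fun P l => u P l ^+ 2)).
  by rewrite (dsumC (fun s l => w s l ^+ 2)) /dsum; ring.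
rewrite -sumN [LHS](eq_dsum (H := fun l l' => N l * D l l' + N l' * D l l'
  + 2 * (D l l' * zz l l'))).
  rewrite !dsumD dsumZ dsumMl dsumMr.
  under eq_bigr => l _ do rewrite sum_isk.
  have -> : \sum_l' N l' * \sum_l D l l' = \sum_l' N l' * q ^+ 4.
    apply: eq_bigr => l' _; rewrite -(sum_isk l'); congr (_ * _).
    by apply: eq_bigr => l _; exact: isk_sym.
  by rewrite -mulr_suml; ring.
move=> l l'; rewrite /D; case: (boolP (skew l l')) => skll'; last by rewrite /=; ring.
by rewrite (sum_residual_sqr skll') /N /=; ring.
Qed.

(** The absence of opposite pairs is rewritten as the vanishing of a sum of three nonnegative
    quantities: the gap in the line-weight bound, the squares of [skew_form_sos], and [Z / 2]. *)
Lemma extremal :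
  [/\ forall P l, pure_part u P l = 0,
      forall s l, @pure_part (dual G) w s l = 0,
      forall s, plane_sum u s = q * @pt_avg (dual G) w s &
      forall P l s P' l' s', skew l l' -> on_pl P l -> on_lp l s ->
        on_pl P' l' -> on_lp l' s' -> on_pp P s' -> on_pp P' s ->
        z P l s + z P' l' s' = 0].
Proof.
have q2 := gq_ge2 G; have q1_gt0 : 0 < q + 1 by lra.
have r_gt0 : 0 < q ^+ 2 + q + 1 by nra.
have sos := skew_form_sos pl_dev_flag sum_pl_dev lp_dev_flag sum_lp_dev.
have tot := skew_total; have lin := sum_skew_line_wt; have zs := sum_zsq.
set Z := dsum (fun l l' => D l l' * zsq l l') in zs *.
have Z_ge0 : 0 <= Z by apply: dsum_ge0 => l l'; exact: zsq_ge0.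
set DZ := dsum (fun l l' => D l l' * zz l l') in zs tot.
set DX := dsum (fun l l' => D l l' * (x l * x l')) in tot lin.
set x2 := \sum_l x l ^+ 2 in zs lin.
set nuw := dsum _ + dsum _ in sos zs.
set A := \sum_s (_ - _) ^+ 2 in sos.
set B := dsum (fun P s => (_ - _) ^+ 2) in sos.
set C := dsum (fun P l => pure_part u P l ^+ 2) in sos.
set E := dsum (fun s l => _ ^+ 2) in sos.
have A_ge0 : 0 <= A by apply: sumr_ge0 => ? _; exact: sqr_ge0.
have B_ge0 : 0 <= B by exact: dsum_sqr_ge0.
have C_ge0 : 0 <= C by exact: dsum_sqr_ge0.
have E_ge0 : 0 <= E by exact: dsum_sqr_ge0.
have q3 : 0 < q ^+ 3 - q by nra.
have qq : 0 < q * (q ^+ 2 + 1) by nra.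
(* The lower bound on the size enters here: it replaces one factor of [t ^+ 2], so that the
   quadratic bound of [sum_skew_line_wt] becomes linear in [t]. *)
have key : q ^+ 4 * t <= (q / (q + 1)) ^+ 2 * (DX + q ^+ 2 * x2).
  have t_ge0 : 0 <= t by apply: le_trans chi_large; rewrite !mulr_ge0 ?sqr_ge0 // ltW.
  have q10 : q + 1 != 0 by exact: lt0r_neq0.
  rewrite [leRHS](_ : _ = q ^+ 2 * (DX + q ^+ 2 * x2) / (q + 1) ^+ 2); last by field.
  rewrite ler_pdivlMr ?exprn_gt0 //.
  rewrite -(ler_pM2l r_gt0).
  apply: (@le_trans _ _ (q ^+ 2 * (t ^+ 2 * q ^+ 2))); last first.
    by rewrite [leRHS]mulrCA; apply: ler_wpM2l lin; exact: sqr_ge0.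
  rewrite [X in X <= _](_ : _ = q ^+ 4 * t * ((q + 1) ^+ 2 * (q ^+ 2 + q + 1))); last by ring.
  rewrite [X in _ <= X](_ : _ = q ^+ 4 * t * t); last by ring.
  by apply: ler_wpM2l chi_large; apply: mulr_ge0 t_ge0; exact: exprn_even_ge0.
have total : (q / (q + 1)) ^+ 2 * (DX + q ^+ 2 * x2) - q ^+ 4 * t
    + q / (q + 1) * (q ^+ 3 * nuw - 2 * M) + Z / 2 = 0.
  rewrite -[RHS]tot; have -> : Z / 2 = q ^+ 4 * (t - nuw / (q + 1) - x2 / (q + 1) ^+ 2) + DZ.
    by rewrite zs; field.
  by field.
have qm : 0 < q / (q + 1) by rewrite divr_gt0 //; lra.
have qA := mulr_ge0 (ltW qq) A_ge0; have CE_ge0 := addr_ge0 C_ge0 E_ge0.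
have qCE := mulr_ge0 (ltW q3) CE_ge0.
have S_ge0 : 0 <= q * (q ^+ 2 + 1) * A + B + (q ^+ 3 - q) * (C + E).
  exact: addr_ge0 (addr_ge0 qA B_ge0) qCE.
have qS_ge0 := mulr_ge0 (ltW qm) S_ge0.
rewrite sos in total.
have Z0 : Z = 0 by lra.
have /eqP : q / (q + 1) * (q * (q ^+ 2 + 1) * A + B + (q ^+ 3 - q) * (C + E)) = 0 by lra.
rewrite mulf_eq0 (gt_eqF qm) /= => /eqP S0.
have /eqP : q * (q ^+ 2 + 1) * A = 0 by lra.
rewrite mulf_eq0 (gt_eqF qq) /= => /eqP A0.
have /eqP : (q ^+ 3 - q) * (C + E) = 0 by lra.
rewrite mulf_eq0 (gt_eqF q3) /= => /eqP CE0.
split.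
- by apply: dsum_sqr_eq0; rewrite -/C; lra.
- by apply: (@dsum_sqr_eq0 _ _ (fun s l => @pure_part (dual G) w s l)); rewrite -/E; lra.
- move=> s; move/eqP: A0; rewrite psumr_eq0 => [/allP/(_ s (mem_index_enum s))|s' _].
    by rewrite /= sqrf_eq0 subr_eq0 => /eqP.
  exact: sqr_ge0.
move=> P l s P' l' s' skll' Pl ls P'l' l's' Ps' P's.
have := dsum_eq0 zsq_ge0 Z0 l l'; rewrite {1}/D skll' mul1r => zsq0.
have zge P0 s0 P1 s1 : 0 <= i P0 l * j l s0 * i P1 l' * j l' s1 * e P0 s1 * e P1 s0
      * (z P0 l s0 + z P1 l' s1) ^+ 2.
  by apply: mulr_ge0 (sqr_ge0 _); do 5 (apply: mulr_ge0; last exact: ler0n); exact: ler0n.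
have := dsum_eq0 (fun P0 s0 => dsum_ge0 (zge P0 s0)) zsq0 P s.
move/(dsum_eq0 (zge P s))/(_ P' s').
by rewrite /i /j /e Pl ls P'l' l's' Ps' P's !mul1r => /eqP; rewrite sqrf_eq0 => /eqP.
Qed.

End ChamberSet.

(** * Rigidity of the extremal sets *)

Section TwoValued.

Variables (G : space3) (chi : point G -> line G -> plane G -> bool).
Variables (b : line G -> rat) (h : point G -> rat) (k : plane G -> rat).
Hypothesis chi_form : forall P l s, on_pl P l -> on_lp l s ->
  (chi P l s)%:R = b l + h P + k s.

Local Notation q := (gq G).

(** On a common line and plane the difference of [h] is a difference of two values of the 0/1
    indicator. *)
Lemma two_valued_diff P P' : [|| h P == h P', h P == h P' + 1 | h P == h P' - 1].
Proof.
have [l Pl P'l] := exists_join P P'; have [s ls] := exists_lp l.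
have := chi_form Pl ls; have := chi_form P'l ls.
case: (chi P l s); case: (chi P' l s) => /= h1 h2;
  apply/or3P; [apply: Or31|apply: Or32|apply: Or33|apply: Or31]; apply/eqP; lra.
Qed.

(** If both [h] and [k] varied on the flags of [l], each would vary by 1, and their sum would have a
    range of 2, too wide for an indicator. *)
Lemma two_valued_line P P' l s s' : on_pl P l -> on_pl P' l -> on_lp l s -> on_lp l s' ->
  h P != h P' -> k s = k s'.
Proof.
move=> Pl P'l ls ls' /eqP neqh; apply/eqP; case: eqP => // neqk.
have := chi_form Pl ls; have := chi_form P'l ls.
have := chi_form Pl ls'; have := chi_form P'l ls'.
by do 4 case: (chi _ _ _) => /=; move=> *; exfalso;
  first [apply: neqh; lra | apply: neqk; lra | lra].
Qed.

End TwoValued.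

Section Constancy.

Variables (G : space3) (chi : point G -> line G -> plane G -> bool).
Variables (b : line G -> rat) (h : point G -> rat) (k : plane G -> rat).
Hypothesis chi_form : forall P l s, on_pl P l -> on_lp l s ->
  (chi P l s)%:R = b l + h P + k s.
Hypothesis kE : forall s, gq G * k s = \sum_P ipp P s * h P.

Local Notation q := (gq G).
Local Notation e := ipp.

Lemma two_valued_diff_plane s s' : [|| k s == k s', k s == k s' + 1 | k s == k s' - 1].
Proof.
apply: (@two_valued_diff (dual G) (fun s l P => chi P l s) b k h) => s0 l P ls Pl.
by rewrite (chi_form Pl ls) addrAC.
Qed.

Lemma const_of_plane_const : (forall s s', k s = k s') -> forall P P', h P = h P'.
Proof.
move=> kc P P'; have q2 := gq_ge2 G.
have sk X : \sum_s e X s * \sum_Y e Y s * h Y =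
    (q ^+ 2 + q + 1) * (q * k (some_plane G)).
  under eq_bigr => s _ do rewrite -kE (kc s (some_plane G)).
  by rewrite -mulr_suml sum_ipp_r.
have := sk P; rewrite -(sk P') !sum_ipp_fun => /addrI/mulfI; apply.
by apply: lt0r_neq0; nra.
Qed.

Lemma sum_pure_plane s v : (forall P, on_pp P s -> h P = v) ->
  q * k s = (q ^+ 2 + q + 1) * v.
Proof.
move=> hv; rewrite kE -(@sum_ipp_r (dual G) s) mulr_suml.
apply: eq_bigr => P _; rewrite -[@ipp (dual G) s P]/(e P s) /e.
by case: (boolP (on_pp P s)) => [/hv ->|]; rewrite ?mul0r.
Qed.

(** A point [R] common to both planes is joined to points [Q] of [s] and [Q'] of [s'] with values of
    [h] different from that at [R]. The plane [t] through both joins has the same [k] as [s] and as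
    [s'], by [two_valued_line] on each join. *)
Lemma nonpure_planes s s' A B A' B' :
  on_pp A s -> on_pp B s -> h A != h B ->
  on_pp A' s' -> on_pp B' s' -> h A' != h B' -> k s = k s'.
Proof.
move=> As Bs hAB A's' B's' hAB'.
have [l ls ls'] := exists_meet s s'; have [R Rl] := exists_pl l.
have Rs := on_pl_lp Rl ls; have Rs' := on_pl_lp Rl ls'.
have other t C C' : on_pp C t -> on_pp C' t -> h C != h C' ->
    exists2 Q, on_pp Q t & h Q != h R.
  move=> Ct C't hC; case: (eqVneq (h C) (h R)) => [hCR|]; last by exists C.
  by exists C' => //; rewrite -hCR eq_sym.
have [Q Qs hQ] := other _ _ _ As Bs hAB.
have [Q' Q's' hQ'] := other _ _ _ A's' B's' hAB'.
have [n Rn Qn] := exists_join R Q; have [n' Rn' Q'n'] := exists_join R Q'.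
have neq X : h X != h R -> R != X by apply: contraNneq => ->.
have ns := join_on_plane (neq _ hQ) Rn Qn Rs Qs.
have n's' := join_on_plane (neq _ hQ') Rn' Q'n' Rs' Q's'.
have [t nt Q't] := exists_lp_pp n Q'.
have n't := join_on_plane (neq _ hQ') Rn' Q'n' (on_pl_lp Rn nt) Q't.
rewrite (two_valued_line chi_form Qn Rn ns nt hQ).
exact: (two_valued_line chi_form Q'n' Rn' n't n's' hQ').
Qed.

(* If k s1 differed from k s0, then for some P on s1 every plane through P would *)
(* contain exactly q points X with h X <> v, and the number N of all such points *)
(* would satisfy (q + 1) N = q^3 + q, whereas q + 1 divides q^3 + q + 2.         *)
Lemma pure_plane_const s0 s1 v : (forall P, on_pp P s0 -> h P = v) -> k s1 = k s0.
Proof.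
move=> s0v; apply/eqP; apply: contraT => neqk.
have q2 := gq_ge2 G.
have [P Ps1 hP] : exists2 P, on_pp P s1 & h P != v.
  apply/exists_inP; rewrite -[X in is_true X]negbK; apply/negP.
  rewrite negb_exists => /forallP noP; case/eqP: neqk.
  have qn0 : q != 0 by lra.
  apply: (mulfI qn0); rewrite (sum_pure_plane s0v) (@sum_pure_plane s1 v) // => P Ps1.
  by have := noP P; rewrite Ps1 negbK => /eqP.
have kP s : on_pp P s -> k s = k s1.
  move=> Ps; case: (eqVneq s s1) => [-> //|neqs].
  have [l ls ls1] := exists_meet s s1.
  have Pl : on_pl P l := @join_on_plane (dual G) s s1 l P neqs ls ls1 Ps Ps1.
  have [Q Ql Qs0] := exists_pl_pp l s0.
  by apply: (two_valued_line chi_form Pl Ql ls ls1); rewrite (s0v Q).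
have [Q0 Q0s0] : exists Q, on_pp Q s0.
  by have [l _ _] := exists_meet s0 s0; have [Q _ Qs0] := exists_pl_pp l s0; exists Q.
pose g X : rat := (h X != v)%:R.
(* [h] takes only the values [v] and [h P]: any value other than [v] differs from it by 1, and two
   values on different sides of [v] would differ by 2. *)
have hg X : h X - v = (h P - v) * g X.
  rewrite /g; case: eqVneq => [->|neqX] /=; first by ring.
  have := two_valued_diff chi_form X Q0; have := two_valued_diff chi_form P Q0.
  have := two_valued_diff chi_form X P; rewrite (s0v Q0) //.
  move/eqP: neqX => neqX; move/eqP: (hP) => neqP.
  by case/or3P=> /eqP h1 /or3P[] /eqP h2 /or3P[] /eqP h3; try lra;
    exfalso; first [apply: neqX; lra | apply: neqP; lra].
(* [q * (k s - k s0)] is [h P - v] times the number of points of [s] with [h] different from [v];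
   both differences are 1 or -1, so this number is [q]. *)
have sg s : on_pp P s -> \sum_X e X s * g X = q.
  move=> Ps.
  have E : q * (k s1 - k s0) = (h P - v) * \sum_X e X s * g X.
    rewrite mulrBr -(kP s Ps) kE (sum_pure_plane s0v) -(@sum_ipp_r (dual G) s).
    rewrite mulr_suml -sumrB mulr_sumr; apply: eq_bigr => X _.
    by rewrite -[@ipp (dual G) s X]/(e X s) -mulrBr (hg X); ring.
  have S_ge0 : 0 <= \sum_X e X s * g X.
    by apply: sumr_ge0 => X _; apply: mulr_ge0; exact: ler0n.
  have := two_valued_diff_plane s1 s0; have := two_valued_diff chi_form P Q0.
  rewrite (s0v Q0) // (negPf hP) (negPf neqk) /=.
  by case/orP=> /eqP h1 /orP[] /eqP h2; move: E; rewrite h1 h2 => E; nra.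
have := sum_ipp_fun g P.
have gP : g P = 1 by rewrite /g hP.
have -> : \sum_s e P s * \sum_X e X s * g X = \sum_s e P s * q.
  apply: eq_bigr => s _; rewrite {1 3}/e; case: (boolP (on_pp P s)) => [/sg ->//|_].
  by rewrite !mul0r.
rewrite -mulr_suml sum_ipp_r gP /g -natr_sum.
move: (\sum_X _)%N => N; rewrite /gq => eqN.
have : (order G ^ 3 + order G = (order G).+1 * N)%N.
  apply/eqP; rewrite -(eqr_nat rat) natrD natrM natrX -[(order G).+1]addn1 natrD.
  by apply/eqP; lra.
have := order_gt1 G; clear eqN; case: (order G) => // n n_gt0 eqN.
have : (n.+2 %| 2)%N; last by case: n n_gt0 {eqN}.
rewrite -(dvdn_addr _ (dvdn_mulr N (dvdnn n.+2))) -eqN.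
by apply/dvdnP; exists (n.+1 * n + 2)%N; rewrite !expnS expn0; nia.
Qed.

Lemma two_valued_const P P' : h P = h P'.
Proof.
apply: const_of_plane_const => s s'.
pose pure s := [forall A, forall B, on_pp A s && on_pp B s ==> (h A == h B)].
have pureP t : pure t -> exists v, forall A, on_pp A t -> h A = v.
  move=> /forallP pt; have [Q Qt] : exists Q, on_pp Q t.
    by have [l _ _] := exists_meet t t; have [Q _ Qt] := exists_pl_pp l t; exists Q.
  by exists (h Q) => A At; have /forallP/(_ Q) := pt A; rewrite At Qt => /eqP.
have npureP t : ~~ pure t -> exists A B, [/\ on_pp A t, on_pp B t & h A != h B].
  rewrite negb_forall => /existsP[A]; rewrite negb_forall => /existsP[B].
  by rewrite negb_imply => /andP[/andP[At Bt] hAB]; exists A, B.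
case: (boolP (pure s)) => [/pureP[v sv]|/npureP[A [B [As Bs hAB]]]].
  exact/esym/(pure_plane_const s' sv).
case: (boolP (pure s')) => [/pureP[v sv]|/npureP[A' [B' [As' Bs' hAB']]]].
  exact: pure_plane_const sv.
exact: nonpure_planes As Bs hAB As' Bs' hAB'.
Qed.

End Constancy.

(** * Existence of points and lines in general position; pairwise meeting lines *)

Section Lines.

Variable G : space3.
Implicit Types (P : point G) (l : line G) (s : plane G).

Local Notation q := (gq G).
Local Notation i := ipl.
Local Notation j := ilp.
Local Notation e := ipp.

Lemma line_unique P P' l l' : P != P' ->
  on_pl P l -> on_pl P' l -> on_pl P l' -> on_pl P' l' -> l = l'.
Proof.
move=> neqP Pl P'l Pl' P'l'; apply/eqP; apply: contraT => neql.
have := join_points neqP; rewrite (bigD1 l) //= (bigD1 l') 1?eq_sym //=.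
rewrite Pl P'l Pl' P'l' /=.
have : 0 <= \sum_(n | (n != l) && (n != l')) (on_pl P n)%:R * (on_pl P' n)%:R :> rat.
  by apply: sumr_ge0 => n _; apply: mulr_ge0; exact: ler0n.
by lra.
Qed.

Lemma exists_point_off_plane l s : ~~ on_lp l s -> exists2 P, on_pl P l & ~~ on_pp P s.
Proof.
move=> /negPf nls; apply/exists_inP; rewrite -[X in is_true X]negbK.
apply/negP; rewrite negb_exists => /forallP allP.
have := sum_ipl_ipp l s; rewrite (eq_bigr (fun P => i P l)) => [|P _].
  by rewrite sum_ipl_l /j nls mulr0; have := gq_ge2 G; lra.
move: (allP P); rewrite /i /e; case: on_pl => /=; last by rewrite mul0r.
by rewrite negbK => ->; rewrite mulr1.
Qed.

Lemma exists_line_off_plane P s : exists2 l, on_pl P l & ~~ on_lp l s.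
Proof.
apply/exists_inP; rewrite -[X in is_true X]negbK.
apply/negP; rewrite negb_exists => /forallP alll.
have := sum_ipl_ilp P s; rewrite (eq_bigr (fun l => i P l)) => [|l _]; last first.
  move: (alll l); rewrite /i /j; case: on_pl => /=; last by rewrite mul0r.
  by rewrite negbK => ->; rewrite mulr1.
rewrite sum_ipl_r; have : e P s <= 1 by rewrite /e; case: on_pp.
have := gq_ge2 G; nra.
Qed.

(** Two lines cover at most [2 * (q + 1)] points, fewer than the [q ^+ 2 + q + 1] points of the
    plane, since [q] is at least 2. *)
Lemma exists_point_off_lines l l' s : on_lp l s -> on_lp l' s ->
  exists P, [/\ on_pp P s, ~~ on_pl P l & ~~ on_pl P l'].
Proof.
move=> ls l's.
suff /existsP[P /and3P[? ? ?]] : [exists P, [&& on_pp P s, ~~ on_pl P l & ~~ on_pl P l']].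
  by exists P.
rewrite -[X in is_true X]negbK; apply/negP; rewrite negb_exists => /forallP noP.
have : \sum_P e P s <= \sum_P (i P l * e P s + i P l' * e P s).
  apply: ler_sum => P _; move: (noP P); rewrite /i /e.
  by case: on_pp; do 2 case: on_pl => //=; rewrite ?mulr0.
rewrite big_split /= !sum_ipl_ipp /j ls l's (@sum_ipp_r (dual G)).
by rewrite -[gq (dual G)]/q; have := gq_ge2 G => /=; nra.
Qed.

Lemma sum_join_in_plane P P' s : on_pp P s -> on_pp P' s ->
  \sum_l i P l * i P' l * j l s = 1 + q * (P == P')%:R.
Proof.
move=> Ps P's; case: eqVneq => [<-|neqP].
  under eq_bigr => l _ do rewrite ipl_idem.
  by rewrite sum_ipl_ilp /e Ps /=; ring.
rewrite (eq_bigr (fun l => i P l * i P' l)) => [|l _].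
  by rewrite sum_ipl_join (negPf neqP) /=; ring.
rewrite /i /j; case: (boolP (on_pl P l)) => Pl; last by rewrite !mul0r.
case: (boolP (on_pl P' l)) => P'l; last by rewrite !mulr0 mul0r.
by rewrite (join_on_plane neqP Pl P'l Ps P's) mulr1.
Qed.

(** Two distinct lines of the family meet in [P0] and span [s]. A line of the family off [P0] meets
    both in different points, so lies in [s]; once such a line exists, every line through [P0] meets
    it away from [P0] and lies in [s] too. *)
Lemma pairwise_meeting (L : pred (line G)) :
  (forall l l', L l -> L l' -> ~~ skew l l') ->
  (exists P, forall l, L l -> on_pl P l) \/ (exists s, forall l, L l -> on_lp l s).
Proof.
move=> meetL.
case: (pickP [pred ll : line G * line G | [&& L ll.1, L ll.2 & ll.1 != ll.2]]); last first.
  move=> noLL; left; case: (pickP L) => [l1 L1|noL]; last first.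
    by exists (some_point G) => l; rewrite noL.
  have [P Pl1] := exists_pl l1; exists P => l Ll.
  by have := noLL (l1, l); rewrite /= L1 Ll /= => /negbFE/eqP <-.
move=> [l1 l2] /= /and3P[L1 L2 neq12].
have [P0 P1 P2] := skew_pl (meetL _ _ L1 L2).
have [s s1 s2] : exists2 s, on_lp l1 s & on_lp l2 s := @skew_pl (dual G) _ _ (meetL _ _ L1 L2).
have P0s := on_pl_lp P1 s1.
have offP l : L l -> ~~ on_pl P0 l -> on_lp l s.
  move=> Ll nP0l; have [X Xl X1] := skew_pl (meetL _ _ Ll L1).
  have [Y Yl Y2] := skew_pl (meetL _ _ Ll L2).
  have neqXP : X != P0 by apply: contraNneq nP0l => <-.
  have neqXY : X != Y.
    apply: contraNneq neq12 => eqXY; apply/eqP.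
    by apply: (line_unique neqXP) => //; rewrite eqXY.
  exact: join_on_plane neqXY Xl Yl (on_pl_lp X1 s1) (on_pl_lp Y2 s2).
case: (boolP [forall l, L l ==> on_pl P0 l]) => [/forallP allP0|].
  by left; exists P0 => l Ll; have := allP0 l; rewrite Ll.
rewrite negb_forall => /existsP[l3]; rewrite negb_imply => /andP[L3 nP3].
right; exists s => l Ll; case: (boolP (on_pl P0 l)) => [P0l|]; last exact: offP.
have [X Xl X3] := skew_pl (meetL _ _ Ll L3).
have neqXP : X != P0 by apply: contraNneq nP3 => <-.
exact: join_on_plane neqXP Xl P0l (on_pl_lp X3 (offP _ L3 nP3)) P0s.
Qed.

End Lines.

(** * Vanishing of the residual and structure of the extremal sets *)

Section Extremal.

Variables (G : space3) (chi : point G -> line G -> plane G -> bool).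
Hypothesis chi_flag : forall P l s, chi P l s -> on_pl P l && on_lp l s.
Hypothesis chi_free : forall P l s P' l' s', chi P l s -> chi P' l' s' ->
  skew l l' -> on_pp P s' || on_pp P' s.
Hypothesis chi_large : (gq G + 1) ^+ 2 * (gq G ^+ 2 + gq G + 1) <=
  \sum_l line_wt chi l.

Local Notation q := (gq G).
Local Notation i := ipl.
Local Notation j := ilp.
Local Notation e := ipp.
Local Notation z := (residual chi).
Local Notation u := (pl_dev chi).
Local Notation w := (lp_dev chi).

(* For n skew to l and l', the residuals at (P, l, s) and (P, l', s) are both   *)
(* the negative of the residual at the chamber on n that P and s determine.     *)
Lemma residual_pencil P l l' s : on_pl P l -> on_pl P l' -> on_lp l s -> on_lp l' s ->
  z P l s = z P l' s.
Proof.
move=> Pl Pl' ls l's.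
have [Q [Qs nQl nQl']] := exists_point_off_lines ls l's.
have [n Qn nns] := exists_line_off_plane Q s.
have [t nt Pt] := exists_lp_pp n P.
have [_ _ _ opp] := extremal chi_flag chi_free chi_large.
have skln : skew l n by rewrite (skew_coplanar ls Qn Qs) nQl nns.
have skl'n : skew l' n by rewrite (skew_coplanar l's Qn Qs) nQl' nns.
have := opp _ _ _ _ _ _ skln Pl ls Qn nt Pt Qs.
have := opp _ _ _ _ _ _ skl'n Pl' l's Qn nt Pt Qs.
by lra.
Qed.

Lemma residual0 P l s : z P l s = 0.
Proof.
have q2 := gq_ge2 G.
case: (boolP (on_pl P l)) => Pl; last first.
  by rewrite -(residual_ipl chi_flag) /i (negPf Pl) mul0r.
case: (boolP (on_lp l s)) => ls; last first.
  by rewrite -(residual_ilp chi_flag) /j (negPf ls) mul0r.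
(* By [residual_pencil], [Z] is [q + 1] times the residual on any line of the pencil. Inside [s] it
   is a point function with zero sum on every line, hence zero: the lines of [s] through [P] cover
   [P] another [q] times. *)
pose Z X := \sum_n z X n s.
have ZE X n : i X n * j n s * Z X = (q + 1) * z X n s.
  case: (boolP (on_pl X n && on_lp n s)) => [/andP[Xn ns]|nXns]; last first.
    rewrite -(residual_ipl chi_flag X n) -(residual_ilp chi_flag X n) /i /j.
    by move: nXns; rewrite negb_and => /orP[] /negPf ->; rewrite !(mul0r, mulr0).
  rewrite /i /j Xn ns !mul1r.
  transitivity (\sum_m i X m * j m s * z X n s).
    apply: eq_bigr => m _; rewrite -(residual_ipl chi_flag X m) -(residual_ilp chi_flag X m).
    rewrite mulrA /i /j; case: (boolP (on_pl X m)) => Xm; last by rewrite !mul0r.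
    case: (boolP (on_lp m s)) => ms; last by rewrite !(mulr0, mul0r).
    by rewrite (residual_pencil Xm Xn ms ns).
  by rewrite -mulr_suml sum_ipl_ilp /e (on_pl_lp Xn ns) mulr1.
have sumZ : \sum_X Z X = 0.
  by rewrite exchange_big big1 // => n _; exact: sum_residual_point.
have lineZ n : j n s * \sum_X i X n * Z X = 0.
  rewrite mulr_sumr; transitivity ((q + 1) * \sum_X z X n s).
    by rewrite mulr_sumr; apply: eq_bigr => X _; rewrite -ZE; ring.
  by rewrite sum_residual_point mulr0.
have Ps := on_pl_lp Pl ls.
have : \sum_n i P n * (j n s * \sum_X i X n * Z X) = 0.
  by rewrite big1 // => n _; rewrite lineZ mulr0.
have -> : \sum_n i P n * (j n s * \sum_X i X n * Z X) = \sum_X (Z X + q * (Z X * (P == X)%:R)).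
  transitivity (\sum_n \sum_X i P n * i X n * j n s * Z X).
    apply: eq_bigr => n _; rewrite mulrA mulr_sumr; apply: eq_bigr => X _; ring.
  rewrite exchange_big; apply: eq_bigr => X _ /=; rewrite -mulr_suml.
  case: (boolP (on_pp X s)) => Xs; first by rewrite sum_join_in_plane //; ring.
  rewrite [Z X]big1 => [|n _]; first by rewrite !(mul0r, mulr0, addr0).
  rewrite -(residual_ipl chi_flag) -(residual_ilp chi_flag) /i /j.
  case: (boolP (on_pl X n)) => Xn; last by rewrite mul0r.
  case: (boolP (on_lp n s)) => ns; last by rewrite mul0r mulr0.
  by rewrite (on_pl_lp Xn ns) in Xs.
rewrite big_split /= sumZ add0r -mulr_sumr sum_delta.
have := ZE P l; rewrite /i /j Pl ls !mul1r => ->.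
by move/eqP; rewrite !mulf_eq0 => /or3P[/eqP|/eqP|/eqP //]; lra.
Qed.

(** With the residual and the pure parts zero, the indicator has the form treated in
    [two_valued_const]; its point and plane functions are constant, so it depends on the line
    alone. *)
Lemma chi_fibre P l s P' s' :
  chi P l s -> on_pl P' l -> on_lp l s' -> chi P' l s'.
Proof.
move=> cP P'l ls'; have /andP[Pl ls] := chi_flag cP.
have q2 := gq_ge2 G; have m0 : q + 1 != 0 by lra.
have [pu pw hk _] := extremal chi_flag chi_free chi_large.
pose h X := pt_avg u X / (q + 1); pose k t := @pt_avg (dual G) w t / (q + 1).
pose b n := line_wt chi n / (q + 1) ^+ 2 - line_sum u n / (q + 1) ^+ 2
  - @line_sum (dual G) w n / (q + 1) ^+ 2.
have form X n t : on_pl X n -> on_lp n t -> (chi X n t)%:R = b n + h X + k t.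
  move=> Xn nt; have := residual0 X n t; rewrite /residual /ichi.
  have := pu X n; have := pw t n; rewrite /pure_part -[gq (dual G)]/q.
  rewrite -[@ipl (dual G) t n]/(j n t) /i /j Xn nt !mul1r => /eqP.
  rewrite subr_eq0 => /eqP -> /eqP; rewrite subr_eq0 => /eqP -> /eqP.
  by rewrite mulr1 !subr_eq add0r => /eqP ->; rewrite /b /h /k; field.
have kE t : q * k t = \sum_X e X t * h X.
  rewrite /k mulrA -hk mulr_suml; apply: eq_bigr => X _; rewrite /h; ring.
have hc := two_valued_const form kE.
have kc t t' : k t = k t'.
  have qn0 : q != 0 by lra.
  by apply: (mulfI qn0); rewrite !(@sum_pure_plane _ h k kE _ (h P)) // => X _; exact: hc.
have := form _ _ _ P'l ls'; rewrite (hc P' P) (kc s' s) -form // cP.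
by case: (chi P' l s').
Qed.

(** If two lines of the set were skew, [chi_fibre] would allow the points to be moved along them,
    one off each of the two planes, which produces an opposite pair. *)
Lemma extremal_lines :
  (exists P0, forall P l s, chi P l s -> on_pl P0 l) \/
  (exists s0, forall P l s, chi P l s -> on_lp l s0).
Proof.
pose L l := [exists P, exists s, chi P l s].
have LP P l s : chi P l s -> L l by move=> c; apply/existsP; exists P; apply/existsP; exists s.
case: (@pairwise_meeting G L) => [l l'|[P0 LP0]|[s0 Ls0]].
- move=> /existsP[P /existsP[s c]] /existsP[P' /existsP[s' c']].
  apply/negP => sk; have /andP[Pl ls] := chi_flag c; have /andP[Pl' l's'] := chi_flag c'.
  have nls' : ~~ on_lp l s' by apply/negP => ls'; rewrite (lp_not_skew ls' l's') in sk.
  have nl's : ~~ on_lp l' s by apply/negP => l's; rewrite (lp_not_skew ls l's) in sk.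
  have [Q Ql nQs'] := exists_point_off_plane nls'.
  have [Q' Q'l' nQ's] := exists_point_off_plane nl's.
  have := chi_free (chi_fibre c Ql ls) (chi_fibre c' Q'l' l's') sk.
  by rewrite (negPf nQs') (negPf nQ's).
- by left; exists P0 => P l s /LP/LP0.
- by right; exists s0 => P l s /LP/Ls0.
Qed.

End Extremal.

Lemma sum_nonzero (F : finFieldType) (W : {vspace 'rV[F]_4}) :
  \sum_(v : 'rV[F]_4) ((v != 0) && (v \in W))%:R = #|F|%:R ^+ \dim W - 1 :> rat.
Proof.
have cardW : #|[pred v : 'rV[F]_4 | v \in W]| = (#|F| ^ \dim W)%N by exact: card_vspace.
rewrite sum_boolE -natrX -cardW (cardD1 0 [pred v | v \in W]) inE mem0v natrD.
rewrite [1%:R + _]addrC addrK.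
by congr (_%:R); apply: eq_card => v; rewrite !inE.
Qed.

(** * The subspaces of a 4-dimensional vector space *)

Section ProjectiveSpace.

Variable F : finFieldType.

Local Notation V := 'rV[F]_4.
Local Notation subspace := {vspace V}.
Local Notation q := (#|F|%:R : rat).

Definition subk (k : nat) := {U : subspace | \dim U == k}.

Lemma dim_subk k (U : subk k) : \dim (val U) = k.
Proof. exact: eqP (valP U). Qed.

Lemma dim_full : \dim {:V} = 4%N.
Proof. by rewrite dimvf /dim /= mul1n. Qed.

Lemma dim_le4 (U : subspace) : (\dim U <= 4)%N.
Proof. by have := dimvS (subvf U); rewrite dim_full. Qed.

Lemma sum_unique (T : finType) (b : pred T) (x0 : T) :
  b =1 pred1 x0 -> \sum_x (b x)%:R = 1 :> rat.
Proof.
move=> bE; rewrite (bigD1 x0) //= bE /= eqxx big1 ?addr0 // => x.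
by rewrite bE /= => /negPf ->.
Qed.

Lemma sum_subk_above k (W : subspace) : \dim W = k ->
  \sum_(U : subk k) (W <= val U)%VS%:R = 1 :> rat.
Proof.
move=> dimW; pose U0 : subk k := Sub W (introT eqP dimW).
apply: (sum_unique (x0 := U0)) => U /=.
by rewrite -val_eqE /= [RHS]eq_sym eqEdim dimW dim_subk leqnn andbT.
Qed.

Lemma sum_subk_below k (W : subspace) : \dim W = k ->
  \sum_(U : subk k) (val U <= W)%VS%:R = 1 :> rat.
Proof.
move=> dimW; pose U0 : subk k := Sub W (introT eqP dimW).
apply: (sum_unique (x0 := U0)) => U /=.
by rewrite -val_eqE /= eqEdim dimW dim_subk leqnn andbT.
Qed.

Lemma subk_eq k (U U' : subk k) : (U == U') = (val U <= val U')%VS.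
Proof. by rewrite -val_eqE eqEdim !dim_subk leqnn andbT. Qed.

Lemma dim_addv_point (P : subk 1) (U : subspace) : ~~ (val P <= U)%VS ->
  \dim (U + val P)%VS = (\dim U).+1.
Proof.
move=> nPU; have := dimv_sum_cap U (val P); rewrite dim_subk.
suff -> : \dim (U :&: val P) = 0%N by rewrite addn0 addn1.
have := dimvS (capvSr U (val P)); rewrite dim_subk.
case E : (\dim _) => [//|[|//]] _; case/negP: nPU.
have : (U :&: val P == val P)%VS by rewrite eqEdim capvSr E dim_subk.
by move/eqP <-; exact: capvSl.
Qed.

Lemma q_ge2 : 2 <= q.
Proof. by rewrite (ler_nat _ 2) finNzRing_gt1. Qed.

(** Double count of the nonzero vectors of [U] by the points that they span. *)
Lemma sum_points (U : subspace) :
  (q - 1) * \sum_(P : subk 1) (val P <= U)%VS%:R = q ^+ \dim U - 1.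
Proof.
pose nz (W : subspace) := \sum_(v : V) ((v != 0) && (v \in W))%:R : rat.
have nzE W : nz W = q ^+ \dim W - 1 := sum_nonzero W.
rewrite -nzE mulr_sumr.
have lineE (v : V) : v != 0 -> \sum_(P : subk 1) (v \in val P)%:R = 1 :> rat.
  move=> v0; have dv : \dim <[v]>%VS = 1%N by rewrite dim_vline v0.
  by rewrite -[RHS](sum_subk_above dv); apply: eq_bigr => P _; rewrite -memvE.
transitivity (\sum_v \sum_(P : subk 1)
    ((v != 0) && (v \in U))%:R * (v \in val P)%:R : rat); last first.
  apply: eq_bigr => v _; rewrite -mulr_sumr.
  by case: eqP => [_|/eqP/lineE ->]; rewrite ?mul0r ?mulr1.
rewrite exchange_big /=; apply: eq_bigr => P _.
have -> : q - 1 = nz (val P) by rewrite nzE dim_subk expr1.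
case: (boolP (val P <= U)%VS) => [PU|nPU]; rewrite ?mulr1 ?mulr0.
  apply: eq_bigr => v _; rewrite -natrM mulnb -andbA; congr ((_ && _)%:R).
  by apply/idP/andP => [vP|[]//]; rewrite vP (subvP PU).
rewrite big1 // => v _; rewrite -natrM mulnb -andbA.
case: eqP => //= /eqP v0; case: (boolP (v \in U)) => //= vU.
case: (boolP (v \in val P)) => // vP; case/negP: nPU.
suff <- : (<[v]>%VS = val P) by exact: vU.
by apply/eqP; rewrite eqEdim dim_vline v0 dim_subk leqnn andbT; exact: vP.
Qed.

Lemma num_points (U : subspace) (n : rat) :
  (q - 1) * n = q ^+ \dim U - 1 -> \sum_(P : subk 1) (val P <= U)%VS%:R = n.
Proof.
by rewrite -sum_points => /mulfI ->; have := q_ge2 => //; lra.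
Qed.

Lemma sub_points_of_line (l : subk 2) :
  \sum_(P : subk 1) (val P <= val l)%VS%:R = q + 1.
Proof. by apply: num_points; rewrite dim_subk; ring. Qed.

Lemma sub_points_of_plane (s : subk 3) :
  \sum_(P : subk 1) (val P <= val s)%VS%:R = q ^+ 2 + q + 1.
Proof. by apply: num_points; rewrite dim_subk; ring. Qed.

Lemma sub_join_points (P P' : subk 1) : P != P' ->
  \sum_(l : subk 2) (val P <= val l)%VS%:R * (val P' <= val l)%VS%:R = 1 :> rat.
Proof.
rewrite eq_sym subk_eq => /dim_addv_point; rewrite dim_subk => dimPP.
rewrite -[RHS](sum_subk_above dimPP); apply: eq_bigr => l _.
by rewrite -natrM mulnb subv_add.
Qed.

Lemma sub_lines_through (P : subk 1) (W : subspace) : (val P <= W)%VS ->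
  q * \sum_(l : subk 2) (val P <= val l)%VS%:R * (val l <= W)%VS%:R =
  \sum_(X : subk 1) (val X <= W)%VS%:R - 1.
Proof.
move=> PW; transitivity (\sum_(l : subk 2) \sum_(X : subk 1 | X != P)
    (val P <= val l)%VS%:R * (val X <= val l)%VS%:R * (val l <= W)%VS%:R : rat).
  rewrite mulr_sumr; apply: eq_bigr => l _; rewrite -!mulr_suml -mulr_sumr.
  case: (boolP (val P <= val l)%VS) => Pl; last by rewrite !mul0r mulr0.
  have := sub_points_of_line l; rewrite (bigD1 P) //= Pl addrC => /addIr ->.
  by ring.
rewrite exchange_big /= [in RHS](bigD1 P) //= PW addrAC subrr add0r.
apply: eq_bigr => X neqXP; transitivity (\sum_(l : subk 2)
    (val P <= val l)%VS%:R * (val X <= val l)%VS%:R * (val X <= W)%VS%:R : rat).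
  apply: eq_bigr => l _; rewrite -!natrM !mulnb; congr (_%:R); congr nat_of_bool.
  case: (boolP ((val P <= val l)%VS && (val X <= val l)%VS)) => //= /andP[Pl Xl].
  apply/idP/idP => [|XW]; first exact: subv_trans.
  have -> : val l = (val P + val X)%VS; last by rewrite subv_add PW.
  have := neqXP; rewrite subk_eq => /dim_addv_point; rewrite dim_subk => dimPX.
  by apply/esym/eqP; rewrite eqEdim subv_add Pl Xl dimPX dim_subk.
by rewrite -mulr_suml sub_join_points 1?eq_sym // mul1r.
Qed.

Lemma sub_pencil (P : subk 1) (s : subk 3) :
  \sum_(l : subk 2) (val P <= val l)%VS%:R * (val l <= val s)%VS%:R =
  (q + 1) * (val P <= val s)%VS%:R.
Proof.
case: (boolP (val P <= val s)%VS) => Ps.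
  have q0 : q != 0 by have := q_ge2; lra.
  by apply: (mulfI q0); rewrite sub_lines_through // sub_points_of_plane /=; ring.
rewrite mulr0 big1 // => l _; rewrite -natrM mulnb.
by case: (boolP (_ && _)) => // /andP[Pl /(subv_trans Pl)]; rewrite (negPf Ps).
Qed.

Lemma sub_lines_of_point (P : subk 1) :
  \sum_(l : subk 2) (val P <= val l)%VS%:R = q ^+ 2 + q + 1.
Proof.
have q0 : q != 0 by have := q_ge2; lra.
apply: (mulfI q0); have := sub_lines_through (subvf (val P)).
under eq_bigr => l _ do rewrite subvf mulr1.
move=> ->; rewrite (@num_points _ (q ^+ 3 + q ^+ 2 + q + 1)); first by ring.
by rewrite dim_full; ring.
Qed.

Lemma sub_lines_of_plane (s : subk 3) :
  \sum_(l : subk 2) (val l <= val s)%VS%:R = q ^+ 2 + q + 1.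
Proof.
have q10 : q + 1 != 0 by have := q_ge2; lra.
apply: (mulfI q10); rewrite -(sub_points_of_plane s) !mulr_sumr.
under [RHS]eq_bigr => P _ do rewrite -sub_pencil.
rewrite [RHS]exchange_big /=; apply: eq_bigr => l _.
by rewrite -mulr_suml sub_points_of_line.
Qed.

Lemma sub_planes_off (l : subk 2) (P : subk 1) : ~~ (val P <= val l)%VS ->
  \sum_(s : subk 3) (val l <= val s)%VS%:R * (val P <= val s)%VS%:R = 1 :> rat.
Proof.
move=> /dim_addv_point; rewrite dim_subk => dimlP.
rewrite -[RHS](sum_subk_above dimlP); apply: eq_bigr => s _.
by rewrite -natrM mulnb subv_add.
Qed.

(** Double count with points off [l]: each plane on [l] has [q ^+ 2] of them, and each of the
    [q ^+ 3 + q ^+ 2] such points spans one plane with [l]. *)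
Lemma sub_planes_of_line (l : subk 2) :
  \sum_(s : subk 3) (val l <= val s)%VS%:R = q + 1.
Proof.
have q0 : q ^+ 2 != 0 by have := q_ge2 => q2; rewrite expf_neq0 //; lra.
apply: (mulfI q0).
transitivity (\sum_(s : subk 3) \sum_(X : subk 1 | ~~ (val X <= val l)%VS)
    (val l <= val s)%VS%:R * (val X <= val s)%VS%:R : rat).
  rewrite mulr_sumr; apply: eq_bigr => s _; rewrite -mulr_sumr.
  case: (boolP (val l <= val s)%VS) => ls; last by rewrite mulr0 mul0r.
  have := sub_points_of_plane s; rewrite (bigID (fun X : subk 1 => (val X <= val l)%VS)) /=.
  have -> : \sum_(X : subk 1 | (val X <= val l)%VS) (val X <= val s)%VS%:R = q + 1.
    rewrite -(sub_points_of_line l) big_mkcond; apply: eq_bigr => X _.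
    by case: (boolP (val X <= val l)%VS) => // Xl; rewrite (subv_trans Xl ls).
  by move=> h; apply: (addrI (q + 1)); rewrite !mul1r h; ring.
rewrite exchange_big /=; under eq_bigr => X nXl do rewrite sub_planes_off //.
have := @num_points fullv (q ^+ 3 + q ^+ 2 + q + 1).
rewrite dim_full (bigID (fun X : subk 1 => (val X <= val l)%VS)) /= => /(_ _).
have -> : \sum_(X : subk 1 | (val X <= val l)%VS) (val X <= fullv)%VS%:R = q + 1.
  rewrite -(sub_points_of_line l) big_mkcond; apply: eq_bigr => X _.
  by rewrite subvf; case: (val X <= val l)%VS.
under eq_bigr => X _ do rewrite subvf.
move=> h; apply: (addrI (q + 1)); rewrite h; ring.
Qed.

Lemma sub_planes_line_point (l : subk 2) (P : subk 1) :
  \sum_(s : subk 3) (val l <= val s)%VS%:R * (val P <= val s)%VS%:R =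
  1 + q * (val P <= val l)%VS%:R.
Proof.
case: (boolP (val P <= val l)%VS) => Pl; last by rewrite sub_planes_off // mulr0 addr0.
rewrite mulr1 addrC -(sub_planes_of_line l); apply: eq_bigr => s _.
by case: (boolP (val l <= val s)%VS) => ls; rewrite ?mul0r // (subv_trans Pl ls) mulr1.
Qed.

Lemma sub_points_line_plane (l : subk 2) (s : subk 3) :
  \sum_(P : subk 1) (val P <= val l)%VS%:R * (val P <= val s)%VS%:R =
  1 + q * (val l <= val s)%VS%:R.
Proof.
under eq_bigr => P _ do rewrite -natrM mulnb -subv_cap.
apply: num_points; have := dimv_sum_cap (val l) (val s); rewrite !dim_subk.
have := dim_le4 (val l + val s).
case: (boolP (val l <= val s)%VS) => ls.
  by move=> _ _; rewrite (capv_idPl ls) dim_subk /=; ring.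
have : (\dim (val l :&: val s) < 2)%N.
  rewrite ltnNge; apply: contra ls => le2.
  suff <- : (val l :&: val s = val l)%VS by exact: capvSr.
  by apply/eqP; rewrite eqEdim capvSl dim_subk.
move=> d2 d4 dd; have -> : \dim (val l :&: val s) = 1%N by lia.
by rewrite /=; ring.
Qed.

Lemma sub_meet_planes (s s' : subk 3) : s != s' ->
  \sum_(l : subk 2) (val l <= val s)%VS%:R * (val l <= val s')%VS%:R = 1 :> rat.
Proof.
move=> neqs; under eq_bigr => l _ do rewrite -natrM mulnb -subv_cap.
apply: sum_subk_below; have := dimv_sum_cap (val s) (val s'); rewrite !dim_subk.
have := dim_le4 (val s + val s').
have : (\dim (val s :&: val s') < 3)%N.
  rewrite ltnNge; apply: contra neqs => le3; rewrite subk_eq.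
  suff <- : (val s :&: val s' = val s)%VS by exact: capvSr.
  by apply/eqP; rewrite eqEdim capvSl dim_subk.
by move: (\dim _) (\dim _) => d d'; lia.
Qed.

Lemma sub_line_cap (l l' : subk 2) :
  [\/ l = l', l != l' /\ \dim (val l :&: val l') = 1%N |
      l != l' /\ (val l :&: val l')%VS = 0%VS].
Proof.
case: (eqVneq l l') => [|neql]; first by constructor 1.
have := dimvS (capvSl (val l) (val l')); rewrite dim_subk.
case E : (\dim _) => [|[|[|//]]] _; last 1 first.
- case/negP: neql; rewrite subk_eq.
  suff <- : (val l :&: val l' = val l)%VS by exact: capvSr.
  by apply/eqP; rewrite eqEdim capvSl E dim_subk.
- by constructor 3; split => //; apply/eqP; rewrite -dimv_eq0 E.
- by constructor 2.
Qed.

Definition sub_skew (l l' : subk 2) : bool := (val l :&: val l' == 0)%VS.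

Lemma sub_skew_refl (l : subk 2) : sub_skew l l = false.
Proof. by rewrite /sub_skew capvv -dimv_eq0 dim_subk. Qed.

Lemma sub_common_points (l l' : subk 2) :
  \sum_(P : subk 1) (val P <= val l)%VS%:R * (val P <= val l')%VS%:R =
  1 - (sub_skew l l')%:R + q * (l == l')%:R.
Proof.
under eq_bigr => P _ do rewrite -natrM mulnb -subv_cap.
apply: num_points; case: (sub_line_cap l l') => [<-|[neql dim1]|[neql cap0]].
- by rewrite sub_skew_refl capvv dim_subk eqxx /=; ring.
- by rewrite /sub_skew -dimv_eq0 dim1 (negPf neql) /=; ring.
- by rewrite /sub_skew cap0 eqxx dimv0 (negPf neql) /=; ring.
Qed.

Lemma sub_common_planes (l l' : subk 2) :
  \sum_(s : subk 3) (val l <= val s)%VS%:R * (val l' <= val s)%VS%:R =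
  1 - (sub_skew l l')%:R + q * (l == l')%:R.
Proof.
under eq_bigr => P _ do rewrite -natrM mulnb -subv_add.
have := dimv_sum_cap (val l) (val l'); rewrite !dim_subk.
case: (sub_line_cap l l') => [<-|[neql dim1]|[neql cap0]] dims.
- rewrite sub_skew_refl eqxx (addvv (val l)) sub_planes_of_line /=; ring.
- rewrite sum_subk_above; last by move: dims; rewrite dim1; lia.
  by rewrite /sub_skew -dimv_eq0 dim1 (negPf neql) /=; ring.
- rewrite big1 => [|s _].
    by rewrite /sub_skew cap0 eqxx (negPf neql) /=; ring.
  case: (boolP (_ <= _)%VS) => // /dimvS; rewrite dim_subk => le3.
  by move: dims; rewrite cap0 dimv0; lia.
Qed.

Lemma dim_const1 : \dim <[(const_mx 1)%R : V]>%VS == 1%N.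
Proof.
have v0 : (const_mx 1 : V) != 0.
  by apply/eqP => /matrixP/(_ ord0 ord0)/eqP; rewrite !mxE oner_eq0.
by rewrite dim_vline v0.
Qed.

Lemma dim_const1C : \dim (<[(const_mx 1)%R : V]>^C)%VS == 3%N.
Proof. by rewrite dimv_compl (eqP dim_const1) dim_full. Qed.

Definition const_point : subk 1 := exist (fun U : subspace => \dim U == 1%N) _ dim_const1.
Definition const_plane : subk 3 := exist (fun U : subspace => \dim U == 3%N) _ dim_const1C.

Definition PG3 : space3 :=
  @Space3 (subk 1) (subk 2) (subk 3) #|F|
    (fun P l => (val P <= val l)%VS) (fun l s => (val l <= val s)%VS)
    (fun P s => (val P <= val s)%VS) sub_skew
    const_point const_plane (finNzRing_gt1 F)
    sub_points_of_line sub_planes_of_line sub_lines_of_point sub_lines_of_plane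
    sub_join_points sub_meet_planes sub_pencil
    sub_points_line_plane sub_planes_line_point
    sub_common_points sub_common_planes.

End ProjectiveSpace.

(** * Transfer to chambers and conclusion *)

Section ChamberGeometry.

Variable F : finFieldType.

Implicit Types (C D : chamber F) (A B : {set chamber F}).

Lemma chamber_axioms C :
  [/\ (chamber1 C <= chamber2 C)%VS, (chamber2 C <= chamber3 C)%VS,
      \dim (chamber1 C) == 1%N, \dim (chamber2 C) == 2%N & \dim (chamber3 C) == 3%N].
Proof.
by case: C => [[[U1 U2] U3] c]; rewrite /chamber1 /chamber2 /chamber3 /=; apply/and5P.
Qed.

Lemma dim_chamber1 C : \dim (chamber1 C) == 1%N. Proof. by case: (chamber_axioms C). Qed.
Lemma dim_chamber2 C : \dim (chamber2 C) == 2%N. Proof. by case: (chamber_axioms C). Qed.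
Lemma dim_chamber3 C : \dim (chamber3 C) == 3%N. Proof. by case: (chamber_axioms C). Qed.

Definition flag C : subk F 1 * subk F 2 * subk F 3 :=
  (exist (fun U : {vspace _} => \dim U == 1%N) _ (dim_chamber1 C),
   exist (fun U : {vspace _} => \dim U == 2%N) _ (dim_chamber2 C),
   exist (fun U : {vspace _} => \dim U == 3%N) _ (dim_chamber3 C)).

Lemma flag_inj : injective flag.
Proof.
move=> C D [e1 e2 e3]; apply: val_inj.
rewrite [val C]surjective_pairing [(val C).1]surjective_pairing.
rewrite [val D]surjective_pairing [(val D).1]surjective_pairing.
by move: e1 e2 e3; rewrite /chamber1 /chamber2 /chamber3 => -> -> ->.
Qed.

Definition flag_in A (P : point (PG3 F)) (l : line (PG3 F)) (s : plane (PG3 F)) : bool :=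
  (P, l, s) \in flag @: A.

Lemma flag_inP A P l s : reflect (exists2 C, C \in A &
  [/\ chamber1 C = val P, chamber2 C = val l & chamber3 C = val s]) (flag_in A P l s).
Proof.
apply: (iffP imsetP) => [[C CA [-> -> ->]]|[C CA [e1 e2 e3]]]; exists C => //.
by congr (_, _, _); apply: val_inj.
Qed.

Lemma card_flag_in A : \sum_l line_wt (flag_in A) l = #|A|%:R.
Proof.
rewrite -(card_imset _ flag_inj) -sum_boolE /line_wt /dsum exchange_big /=.
rewrite pair_bigA pair_bigA /=; apply: eq_bigr => -[[P l] s] _.
by rewrite /ichi /flag_in.
Qed.

Lemma flag_in_pencil (P0 : subk F 1) P l s :
  flag_in [set C | (val P0 <= chamber2 C)%VS] P l s =
  [&& (val P0 <= val l)%VS, (val P <= val l)%VS & (val l <= val s)%VS].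
Proof.
apply/flag_inP/and3P => [[C + [e1 e2 e3]]|[P0l Pl ls]].
  by rewrite inE -e1 -e2 -e3; case: (chamber_axioms C).
have c : is_chamber (val P, val l, val s).
  by rewrite /is_chamber Pl ls !dim_subk.
by exists (Chamber c) => //; rewrite inE.
Qed.

Lemma card_pencil (P0 : subk F 1) :
  #|[set C | (val P0 <= chamber2 C)%VS]|%:R =
  (#|F|%:R + 1) ^+ 2 * (#|F|%:R ^+ 2 + #|F|%:R + 1) :> rat.
Proof.
rewrite -card_flag_in -(sub_lines_of_point P0) mulr_sumr; apply: eq_bigr => l _.
transitivity (dsum (fun (P : subk F 1) (s : subk F 3) =>
   (val P0 <= val l)%VS%:R * (val P <= val l)%VS%:R * (val l <= val s)%VS%:R)).
  by apply: eq_dsum => P s; rewrite /ichi flag_in_pencil -!natrM !mulnb andbA.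
rewrite (dsum_prod (fun P : subk F 1 => (val P0 <= val l)%VS%:R * (val P <= val l)%VS%:R)).
by rewrite -mulr_sumr sub_points_of_line sub_planes_of_line; ring.
Qed.

Lemma not_opposite C D : (chamber2 C :&: chamber2 D)%VS <> 0%VS -> ~~ opposite C D.
Proof. by move/eqP=> CD; rewrite /opposite (negPf CD) andbF. Qed.

Lemma pencil_meet (P : {vspace 'rV[F]_4}) C D : \dim P = 1%N ->
  (P <= chamber2 C)%VS -> (P <= chamber2 D)%VS -> (chamber2 C :&: chamber2 D)%VS <> 0%VS.
Proof.
move=> dimP PC PD CD0; have : (P <= chamber2 C :&: chamber2 D)%VS by rewrite subv_cap PC.
by rewrite CD0 subv0 -dimv_eq0 dimP.
Qed.

Lemma plane_meet (H : {vspace 'rV[F]_4}) C D : \dim H = 3%N ->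
  (chamber2 C <= H)%VS -> (chamber2 D <= H)%VS -> (chamber2 C :&: chamber2 D)%VS <> 0%VS.
Proof.
move=> dimH CH DH CD0; have /dimvS : (chamber2 C + chamber2 D <= H)%VS by rewrite subv_add CH.
have := dimv_sum_cap (chamber2 C) (chamber2 D).
by rewrite CD0 dimv0 addn0 dimH => ->; rewrite (eqP (dim_chamber2 C)) (eqP (dim_chamber2 D)).
Qed.

Lemma classical_meet A C D : classical_type A -> C \in A -> D \in A ->
  (chamber2 C :&: chamber2 D)%VS <> 0%VS.
Proof.
case=> [[P [dimP ->]]|[H [dimH ->]]]; rewrite !inE.
  exact: pencil_meet.
exact: plane_meet.
Qed.

Lemma classical_EKR A : classical_type A -> EKR_set A.
Proof. by move=> clA C D CA DA; apply/not_opposite/(classical_meet clA). Qed.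

(** It suffices to place [A] inside some set of classical type: that set is itself EKR, hence no
    larger than the maximum set [A]. Comparison with one point pencil supplies the size required by
    [extremal_lines]. *)
Lemma maximum_EKR_classical A : maximum_EKR_set A -> classical_type A.
Proof.
case=> ekrA maxA.
have sub_classical B : classical_type B -> A \subset B -> classical_type A.
  by move=> clB AB; have /eqP -> : A == B by rewrite eqEcard AB maxA //; exact: classical_EKR.
pose P0 := const_point F.
have large : (gq (PG3 F) + 1) ^+ 2 * (gq (PG3 F) ^+ 2 + gq (PG3 F) + 1) <=
    \sum_l line_wt (flag_in A) l.
  rewrite card_flag_in -[gq (PG3 F)]/(#|F|%:R) -(card_pencil P0) ler_nat maxA //.
  by apply: classical_EKR; left; exists (val P0); rewrite dim_subk.
have flagA P l s : flag_in A P l s -> on_pl P l && on_lp l s.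
  move=> /flag_inP[C _ [e1 e2 e3]]; rewrite /= -e1 -e2 -e3.
  by case: (chamber_axioms C) => -> ->.
have freeA P l s P' l' s' : flag_in A P l s -> flag_in A P' l' s' -> skew l l' ->
    on_pp P s' || on_pp P' s.
  move=> /flag_inP[C CA [e1 e2 e3]] /flag_inP[D DA [d1 d2 d3]] /= sk.
  have := ekrA C D CA DA; rewrite /opposite e1 e2 e3 d1 d2 d3.
  rewrite [(val l :&: _ == _)%VS]sk /= negb_and [(val s :&: _)%VS]capvC.
  have pt (U : subk F 1) W : (val U :&: W != 0)%VS -> (val U <= W)%VS.
    apply: contraR => /dim_addv_point; have := dimv_sum_cap W (val U).
    by rewrite capvC => + dimWU; rewrite dimWU dim_subk -dimv_eq0; lia.
  by case/orP=> /pt ->; rewrite ?orbT.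
case: (extremal_lines flagA freeA large) => [[Q QA]|[s sA]].
  apply: (sub_classical [set C | (val Q <= chamber2 C)%VS]).
    by left; exists (val Q); rewrite dim_subk.
  apply/subsetP => C CA; rewrite inE; apply: (QA (flag C).1.1 (flag C).1.2 (flag C).2).
  by apply/flag_inP; exists C.
apply: (sub_classical [set C | (chamber2 C <= val s)%VS]).
  by right; exists (val s); rewrite dim_subk.
apply/subsetP => C CA; rewrite inE; apply: (sA (flag C).1.1 (flag C).1.2 (flag C).2).
by apply/flag_inP; exists C.
Qed.

End ChamberGeometry.

Theorem theorem1p4 (q p k : nat) (p_prime : prime p) (k_gt0 : (0 < k)%N)
    (q_def : q = (p ^ k)%N) (F : finFieldType) (cardF : #|F| = q) :
  (forall A : {set chamber F}, maximum_EKR_set A -> classical_type A)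
  /\
  (forall A : {set chamber F}, maximum_EKR_set A ->
     forall C D : chamber F, C \in A -> D \in A ->
       (chamber2 C :&: chamber2 D)%VS <> 0%VS).
Proof.
split=> [A|A maxA C D]; first exact: maximum_EKR_classical.
exact: classical_meet (maximum_EKR_classical maxA).
Qed.
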